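(* Let $p\in(0,1)$ be a fixed constant and $\beta\ge0$ a fixed real number. For an even integer $n=2s$, let $M$ be the $n\times n$ matrix with $m_{ij}=p$ if $1\le|i-j|\le s-1$ and $0$ otherwise, and let $\widehat M$ be a random symmetric $n\times n$ matrix with zero diagonal whose entries $\widehat m_{ij}$, $i<j$, are independent Bernoulli variables with $\mathbb P(\widehat m_{ij}=1)=m_{ij}$. Let $u\in\mathbb R^n$ be given by $u_j=\cos\left(\frac{(2j-1)\pi}{4s+2}\right)$ for $j=1,\dots,s$ and $u_j=-u_{n-j+1}$ for $j=s+1,\dots,n$, and let $y$ be a unit eigenvector of $\widehat M$ for $\lambda_2(\widehat M)$ with sign chosen so that $\langle y,u\rangle\ge0$. Let $k=n^{\beta}$. Then there is a constant $C>0$ (independent of $n$) such that, with probability at least $1-n^{-3}$, \[ D_{k,1}(y)<Cn^{\frac{7-2\beta}{3}}. \]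
   Context: Eigenvalues of a symmetric matrix $X$ are labelled so that $|\lambda_1(X)|\ge|\lambda_2(X)|\ge\dots$; $\lambda_2(X)$ is the one of second largest absolute value. For $y\in\mathbb R^n$ and reals $k,r$, \[ D_{k,r}(y)=\left|\{(i,j): y_j>y_i,\ i+k\le j,\ r\le i\}\right|. \] *)

(* Defs.v *)
From HB Require Import structures.
From mathcomp Require Import all_boot all_order all_algebra.
From mathcomp Require Import all_classical all_reals all_analysis.
Set Implicit Arguments. Unset Strict Implicit. Unset Printing Implicit Defensive.
Import Order.TTheory GRing.Theory Num.Theory.
Local Open Scope ring_scope.

(* Indices are 0-based ('I_n); paper index i corresponds to i.+1. *)

Definition Dkr (R : realType) (n : nat) (k r : R) (y : 'cV[R]_n) : nat :=
  #|[set ij : 'I_n * 'I_n |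
      (y ij.1 ord0 < y ij.2 ord0) &&
      (((ij.1.+1)%:R + k <= ((ij.2.+1)%:R : R)) && (r <= (ij.1.+1)%:R))] |.

Definition Mmat (R : realType) (s : nat) (p : R) : 'M[R]_(2 * s) :=
  \matrix_(i, j) (if [&& i != j, (i - j <= s - 1)%N & (j - i <= s - 1)%N]
                  then p else 0).

(* Sample space: boolean matrices w; only the strictly upper-triangular
   entries w i j (i < j) are meaningful. The probability weight of w is the
   product of independent Bernoulli(m_ij) weights over i < j, and 0 when w
   has a true entry outside the strict upper triangle (so the weights form a
   probability distribution on the admissible outcomes). *)
Definition upper_only (n : nat) (w : 'M[bool]_n) : bool :=
  [forall i, forall j, w i j ==> (i < j)%N].

Definition weight (R : realType) (n : nat) (m : 'M[R]_n) (w : 'M[bool]_n) : R :=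
  (upper_only w)%:R *
  \prod_(i : 'I_n) \prod_(j : 'I_n | (i < j)%N)
      (if w i j then m i j else 1 - m i j).

Definition Mhat (R : realType) (n : nat) (w : 'M[bool]_n) : 'M[R]_n :=
  \matrix_(i, j) (if (i < j)%N then (w i j)%:R
                  else if (j < i)%N then (w j i)%:R else 0).

Definition eig_labelling (R : realType) (n : nat) (A : 'M[R]_n)
    (lam : 'I_n -> R) : Prop :=
  char_poly A = \prod_(i < n) ('X - (lam i)%:P) /\
  (forall i j : 'I_n, (i <= j)%N -> `|lam j| <= `|lam i|).

Definition uvec (R : realType) (s : nat) : 'cV[R]_(2 * s) :=
  \col_(i < 2 * s)
    (if (i < s)%N
     then cos (((2 * i + 1)%N%:R * pi) / (4 * s + 2)%N%:R)
     else - cos (((2 * (2 * s - 1 - i) + 1)%N%:R * pi) / (4 * s + 2)%N%:R)).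

Definition dotv (R : realType) (n : nat) (x y : 'cV[R]_n) : R :=
  \sum_(i < n) x i ord0 * y i ord0.

(* Main.v *)
Require Import Defs.
From HB Require Import structures.
From mathcomp Require Import all_boot all_order all_algebra.
From mathcomp Require Import ring lra zify.
From mathcomp Require Import all_classical all_reals all_analysis.
Import Order.TTheory GRing.Theory Num.Theory.
Import numFieldNormedType.Exports.
Local Open Scope ring_scope.

(** Write M = p (B - 1) with B the 0/1 band matrix, n = 2s.  The vector u is an eigenvector of B,
    with eigenvalue mu = 1 / (2 sin (pi / (4s + 2))) >= 5s/8.  Let e be the normalised all-ones
    vector, rho = <e, Be> and f = Be - rho e.  Removing from B the part carried by u, e and f leaves
    a matrix whose squared Frobenius norm is 7s^2/12 - mu^2 up to lower order terms, hence of
    operator norm at most 9s/20: this separates mu from the rest of the spectrum of B without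
    computing that spectrum.

    Chernoff bounds for x^T (Mhat - M) y, summed over the lattice points of norm at most 4 sqrt n,
    show that Mhat - M has operator norm O(sqrt n) outside an event of probability at most n^-3.
    Then |lambda_2(Mhat)| = p mu + O(sqrt n), and y is at distance O(n^(-1/2)) of the
    normalised u.

    Finally u_i - u_j >= tau k / (8 n^2) if j - i >= k and both indices are at distance at least
    tau from the ends.  At most 2 tau n inverted pairs violate the distance condition, and any other
    inversion forces a large coordinate of the error at i or j, so there are
    O(n^5 / (tau k)^2) of these; tau = n^((4 - 2 beta) / 3) balances the two counts. *)

Set Implicit Arguments.
Unset Strict Implicit.
Unset Printing Implicit Defensive.

(** * Trigonometric estimates *)

Section Trigonometry.
Variable R : realType.
Implicit Types x y : R.

(** Mean value theorem on [[0, x]]. Starting from [cos <= 1], it yields the next four bounds in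
    turn, each difference having the preceding one as its derivative. *)
Lemma ge0_of_derive_ge0 (f df : R -> R) x :
  (forall y, is_derive y 1 f (df y)) -> (forall y, 0 <= y -> 0 <= df y) ->
  f 0 = 0 -> 0 <= x -> 0 <= f x.
Proof.
move=> fd df0 f0 x0.
have cf : ({within `[0, x], continuous f})%classic.
  apply: continuous_subspaceT => z.
  by apply: differentiable_continuous; apply/derivable1_diffP; have [] := fd z.
have [c /andP[c0 _] h] := MVT_segment x0 (fun y _ => fd y) cf.
by move: h; rewrite f0 !subr0 => ->; rewrite mulr_ge0 // df0.
Qed.

Lemma sin_le_id x : 0 <= x -> sin x <= x.
Proof.
move=> x0; rewrite -subr_ge0.
apply: (@ge0_of_derive_ge0 (fun y => y - sin y) (fun y => 1 - cos y)) => //.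
- by rewrite sin0 subr0.
Qed.

Lemma cos_ge_quadratic x : 0 <= x -> 1 - x ^+ 2 / 2 <= cos x.
Proof.
move=> x0; rewrite -subr_ge0.
apply: (@ge0_of_derive_ge0 (fun y => cos y - (1 - y ^+ 2 / 2)) (fun y => y - sin y)) => //.
- move=> y; apply: is_derive_eq; rewrite /GRing.scale /=. by field.
- by move=> y y0; rewrite subr_ge0 sin_le_id.
- by rewrite cos0; ring.
Qed.

Lemma sin_ge_cubic x : 0 <= x -> x - x ^+ 3 / 6 <= sin x.
Proof.
move=> x0; rewrite -subr_ge0.
apply: (@ge0_of_derive_ge0 (fun y => sin y - (y - y ^+ 3 / 6))
  (fun y => cos y - (1 - y ^+ 2 / 2))) => //.
- move=> y; apply: is_derive_eq; rewrite /GRing.scale /=. by field.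
- by move=> y y0; rewrite subr_ge0 cos_ge_quadratic.
- by rewrite sin0; ring.
Qed.

Lemma cos_le_quartic x : 0 <= x -> cos x <= 1 - x ^+ 2 / 2 + x ^+ 4 / 24.
Proof.
move=> x0; rewrite -subr_ge0.
apply: (@ge0_of_derive_ge0 (fun y => 1 - y ^+ 2 / 2 + y ^+ 4 / 24 - cos y)
  (fun y => sin y - (y - y ^+ 3 / 6))) => //.
- move=> y; apply: is_derive_eq; rewrite /GRing.scale /=. by field.
- by move=> y y0; rewrite subr_ge0 sin_ge_cubic.
- by rewrite cos0; ring.
Qed.

(** At 8/5 the quartic upper bound for [cos] is negative, whereas [cos] is nonnegative up to
    [pi / 2]. *)
Lemma pi_lt_3_2 : pi < 16 / 5 :> R.
Proof.
rewrite ltNge; apply/negP => h.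
have := @cos_le_quartic (8 / 5); have := @cos_ge0_pihalf R (8 / 5).
have := @pi_gt0 R; lra.
Qed.

(** Since [pi / 2 < 8 / 5], the cubic term [x ^+ 3 / 6] is at most [x / 2] on this range. *)
Lemma sin_ge_half x : 0 <= x <= pi / 2 -> x / 2 <= sin x.
Proof.
move=> /andP[x0 x1]; have := sin_ge_cubic x0; have := pi_lt_3_2.
move=> h1 h2; nra.
Qed.

End Trigonometry.

(** * Euclidean vectors *)

Section EuclideanVectors.
Variables (R : realType) (n : nat).
Implicit Types (x y z : 'cV[R]_n) (A : 'M[R]_n) (a : R).

Lemma dotvE x y : dotv x y = (x^T *m y) ord0 ord0.
Proof. by rewrite mxE; apply: eq_bigr => i _; rewrite mxE. Qed.

Lemma dotvC x y : dotv x y = dotv y x.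
Proof. by apply: eq_bigr => i _; rewrite mulrC. Qed.

Lemma dotvDl x y z : dotv (x + y) z = dotv x z + dotv y z.
Proof. by rewrite -big_split /=; apply: eq_bigr => i _; rewrite mxE mulrDl. Qed.

Lemma dotvZl a x y : dotv (a *: x) y = a * dotv x y.
Proof. by rewrite mulr_sumr; apply: eq_bigr => i _; rewrite mxE mulrA. Qed.

Lemma dotvNl x y : dotv (- x) y = - dotv x y.
Proof. by rewrite -scaleN1r dotvZl mulN1r. Qed.

Lemma dotvDr x y z : dotv x (y + z) = dotv x y + dotv x z.
Proof. by rewrite dotvC dotvDl !(dotvC x). Qed.

Lemma dotvZr a x y : dotv x (a *: y) = a * dotv x y.
Proof. by rewrite dotvC dotvZl dotvC. Qed.

Lemma dotvNr x y : dotv x (- y) = - dotv x y.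
Proof. by rewrite dotvC dotvNl dotvC. Qed.

Lemma dotvBr x y z : dotv x (y - z) = dotv x y - dotv x z.
Proof. by rewrite dotvDr dotvNr. Qed.

Definition dotv_lin := (dotvDl, dotvDr, dotvNl, dotvNr, dotvZl, dotvZr).

Lemma dotv0 x : dotv x 0 = 0.
Proof. by rewrite -(scale0r 0) dotvZr mul0r. Qed.

Lemma dotv_mul A x y : dotv (A *m x) y = dotv x (A^T *m y).
Proof. by rewrite !dotvE trmx_mul mulmxA. Qed.

Lemma dotv_ge0 x : 0 <= dotv x x.
Proof. by apply: sumr_ge0 => i _; rewrite -expr2 sqr_ge0. Qed.

Lemma dotv_sqr x : dotv x x = \sum_i x i ord0 ^+ 2.
Proof. by apply: eq_bigr => i _; rewrite expr2. Qed.

Lemma dotv_eq0 x : dotv x x = 0 -> x = 0.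
Proof.
move=> /eqP; rewrite psumr_eq0 => [/allP h|i _]; last by rewrite -expr2 sqr_ge0.
apply/matrixP => i j; rewrite mxE [j]ord1.
by have := h i (mem_index_enum _); rewrite -expr2 sqrf_eq0 => /eqP.
Qed.

Lemma dotv_gt0 x : x != 0 -> 0 < dotv x x.
Proof. by move=> x0; rewrite lt_def dotv_ge0 andbT; apply: contra_neq x0 => /dotv_eq0. Qed.

Lemma cauchy_schwarz_sqr x y : dotv x y ^+ 2 <= dotv x x * dotv y y.
Proof.
have [->|y0] := eqVneq y 0; first by rewrite !dotv0 expr0n mulr0.
have p := dotv_gt0 y0.
(* Up to the factor [dotv y y], this vector is the component of [x] orthogonal to [y]. *)
have := dotv_ge0 (dotv y y *: x - dotv x y *: y).
rewrite !dotv_lin (dotvC y x).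
rewrite [X in 0 <= X](_ : _ =
   dotv y y * (dotv x x * dotv y y - dotv x y ^+ 2)); last by ring.
by rewrite pmulr_rge0 // subr_ge0.
Qed.

Definition vnorm x : R := Num.sqrt (dotv x x).

Lemma vnorm_ge0 x : 0 <= vnorm x. Proof. exact: sqrtr_ge0. Qed.

Lemma sqr_vnorm x : vnorm x ^+ 2 = dotv x x.
Proof. by rewrite sqr_sqrtr // dotv_ge0. Qed.

Lemma vnormZ a x : vnorm (a *: x) = `|a| * vnorm x.
Proof. by rewrite /vnorm !dotv_lin mulrA -expr2 sqrtrM ?sqr_ge0 // sqrtr_sqr. Qed.

Lemma vnormN x : vnorm (- x) = vnorm x.
Proof. by rewrite -scaleN1r vnormZ normrN1 mul1r. Qed.

Lemma vnorm_le x a : 0 <= a -> (vnorm x <= a) = (dotv x x <= a ^+ 2).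
Proof. by move=> a0; rewrite -sqr_vnorm ler_sqr ?nnegrE // vnorm_ge0. Qed.

Lemma cauchy_schwarz x y : `|dotv x y| <= vnorm x * vnorm y.
Proof.
rewrite -ler_sqr ?nnegrE ?mulr_ge0 ?vnorm_ge0 // exprMn !sqr_vnorm real_normK ?num_real //.
exact: cauchy_schwarz_sqr.
Qed.

Lemma vnormD x y : vnorm (x + y) <= vnorm x + vnorm y.
Proof.
rewrite vnorm_le ?addr_ge0 ?vnorm_ge0 // sqrrD !sqr_vnorm !dotv_lin (dotvC y x).
have := cauchy_schwarz x y; have := ler_norm (dotv x y); lra.
Qed.

Lemma vnormB x y : vnorm x - vnorm y <= vnorm (x + y).
Proof.
rewrite lerBlDr; have := vnormD (x + y) (- y); rewrite addrK vnormN; exact.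
Qed.

Lemma vnorm_mul_le_frobenius A x :
  dotv (A *m x) (A *m x) <= (\sum_i \sum_j A i j ^+ 2) * dotv x x.
Proof.
rewrite dotv_sqr mulr_suml; apply: ler_sum => i _.
have := cauchy_schwarz_sqr (\col_j A i j) x.
have -> : (A *m x) i ord0 = dotv (\col_j A i j) x.
  by rewrite mxE; apply: eq_bigr => j _; rewrite mxE.
rewrite dotv_sqr; under eq_bigr do rewrite mxE; exact.
Qed.

End EuclideanVectors.

(** * Spectral theorem for real symmetric matrices *)

Section SpectralTheorem.
Variable R : realType.

(* A Householder reflection carries the first basis vector to [v]. *)
Lemma orthogonal_with_first_row n (v : 'rV[R]_n.+1) : v *m v^T = 1%:M ->
  exists H : 'M[R]_n.+1, H *m H^T = 1%:M /\ row ord0 H = v.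
Proof.
move=> vv; pose e : 'rV[R]_n.+1 := row ord0 1%:M.
have ee : e *m e^T = 1%:M.
  by rewrite /e row1 trmx_delta mul_delta_mx; apply/matrixP => i j; rewrite !mxE !ord1.
have [ev|nev] := eqVneq v e.
  by exists 1%:M; rewrite trmx1 mulmx1.
pose w := e - v.
pose c := (w *m w^T) ord0 ord0.
have w0 : w != 0 by rewrite subr_eq0 eq_sym.
have ww : w *m w^T = c%:M by rewrite [LHS]mx11_scalar.
have c0 : c != 0.
  have := dotv_gt0 (_ : w^T != 0); rewrite trmx_eq0 => /(_ w0).
  by rewrite dotvE trmxK; apply: lt0r_neq0.
(* As [e] and [v] have the same length, |e - v|^2 = 2 <e, e - v>. *)
have ew : (e *m w^T) = (c / 2)%:M.
  have h : c%:M = (e *m w^T) *+ 2.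
    rewrite -ww /w linearB /= mulmxBr !mulmxBl ee vv opprB.
    have -> : v *m e^T = e *m v^T.
      by rewrite -[LHS]trmxK trmx_mul trmxK [RHS]mx11_scalar [X in X^T]mx11_scalar tr_scalar_mx.
    by rewrite mulmxBr ee mulr2n addrA.
  rewrite [LHS]mx11_scalar; congr (_%:M).
  move/matrixP/(_ ord0 ord0): h; rewrite mulr2n [LHS]mxE [RHS]mxE eqxx mulr1n => ->.
  by field.
exists (1%:M - (2 / c) *: (w^T *m w)); split.
  set K := w^T *m w.
  have KT : K^T = K by rewrite /K trmx_mul trmxK.
  have KK : K *m K = c *: K.
    by rewrite /K mulmxA -(mulmxA w^T) ww mul_mx_scalar -scalemxAl.
  have -> : (1%:M - (2 / c) *: K)^T = 1%:M - (2 / c) *: K.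
    by rewrite [LHS]linearB [X in _ - X]linearZ /= trmx1 KT.
  rewrite mulmxBr mulmx1 mulmxBl mul1mx -scalemxAl -scalemxAr KK !scalerA.
  rewrite -addrA -opprD -scalerBl -scalerDl.
  set a := (X in X *: _).
  have -> : a = 0 by rewrite /a; field.
  by rewrite scale0r subr0.
rewrite rowE -row1 -/e mulmxBr mulmx1 -scalemxAr mulmxA ew.
by rewrite mul_scalar_mx scalerA (_ : 2 / c * (c / 2) = 1) ?scale1r ?subKr //; field.
Qed.

Lemma char_poly_conj n (A P : 'M[R]_n) : P *m P^T = 1%:M ->
  char_poly (P *m A *m P^T) = char_poly A.
Proof.
move=> PP; rewrite /char_poly.
have PX : map_mx polyC P *m map_mx polyC P^T = 1%:M by rewrite -map_mxM PP map_mx1.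
have -> : char_poly_mx (P *m A *m P^T) =
    map_mx polyC P *m char_poly_mx A *m map_mx polyC P^T.
  rewrite /char_poly_mx mulmxBr mulmxBl !map_mxM /= mul_mx_scalar -scalemxAl.
  by rewrite PX scalemx1.
by rewrite !det_mulmx mulrC mulrA -det_mulmx (mulmx1C PX) det1 mul1r.
Qed.

Lemma char_poly_block_diag n (a : R) (A : 'M[R]_n) :
  char_poly (block_mx a%:M 0 0 A : 'M[R]_(1 + n)) = ('X - a%:P) * char_poly A.
Proof.
rewrite /char_poly /char_poly_mx map_block_mx !map_mx0 map_scalar_mx /=.
rewrite (@scalar_mx_block _ 1 n) opp_block_mx add_block_mx !oppr0 !addr0 det_ublock.
by rewrite -[in LHS]raddfB det_scalar1.
Qed.

(** Induction on [n]. The polynomial is given in split form, so [lam ord0] has a real eigenvector;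
    completing it to an orthogonal matrix and conjugating peels off one row and one column. The
    order of [lam] is preserved. *)
Lemma symmetric_spectral n (A : 'M[R]_n) (lam : 'I_n -> R) : A^T = A ->
  char_poly A = \prod_(i < n) ('X - (lam i)%:P) ->
  exists Q : 'M[R]_n, Q *m Q^T = 1%:M /\ Q *m A = diag_mx (\row_i lam i) *m Q.
Proof.
elim: n A lam => [|n IH] A lam As cA.
  by exists 1%:M; split; apply/matrixP => -[].
have : eigenvalue A (lam ord0).
  rewrite eigenvalue_root_char cA rootE horner_prod big_ord_recl !hornerE subrr mul0r //.
case/eigenvalueP => v0 v0A v0n.
pose c := (v0 *m v0^T) ord0 ord0.
have c0 : 0 < c.
  have := dotv_gt0 (_ : v0^T != 0); rewrite trmx_eq0 => /(_ v0n).
  by rewrite dotvE trmxK.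
pose v := (Num.sqrt c)^-1 *: v0.
have vv : v *m v^T = 1%:M.
  rewrite /v linearZ /= -scalemxAl -scalemxAr scalerA -invfM -expr2 sqr_sqrtr ?ltW //.
  by rewrite [X in _ *: X]mx11_scalar scale_scalar_mx mulVf ?lt0r_neq0.
have vA : v *m A = lam ord0 *: v by rewrite /v -scalemxAl v0A scalerA mulrC -scalerA.
have [H [HH Hv]] := orthogonal_with_first_row vv.
have [B BH] : exists B, B = H *m A *m H^T by exists (H *m A *m H^T).
have Bs : B^T = B by rewrite BH !trmx_mul trmxK As mulmxA.
have B0 : row ord0 B = lam ord0 *: row ord0 1%:M.
  by rewrite BH -mulmxA row_mul Hv mulmxA vA -scalemxAl -Hv -row_mul HH.
(* The first row is [lam ord0] times a basis vector, and symmetry transfers this to the first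
   column. *)
have BE : B = (block_mx (lam ord0)%:M 0 0 (@drsubmx _ 1 n 1 n B) : 'M[R]_(1 + n)).
  have Be j : B ord0 j = (lam ord0) *+ (ord0 == j).
    by move/rowP/(_ j): B0; rewrite !mxE mulr_natr.
  have Be' j : B j ord0 = (lam ord0) *+ (ord0 == j) by rewrite -Bs mxE Be.
  have l0 : @lshift 1 n ord0 = ord0 by apply: val_inj.
  apply: etrans (esym (@submxK _ 1 n 1 n B)) _; congr (@block_mx R 1 n 1 n _ _ _ _);
    apply/matrixP => i j;
    rewrite !mxE ?(ord1 i) ?(ord1 j) l0 ?Be ?Be' //=.
set A' := drsubmx _ in BE.
have A's : A'^T = A'.
  by rewrite /A' trmx_drsub Bs.
have cA' : char_poly A' = \prod_(i < n) ('X - (lam (lift ord0 i))%:P).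
  have := char_poly_conj A HH; rewrite -BH BE char_poly_block_diag cA big_ord_recl.
  by apply: mulfI; rewrite polyXsubC_eq0.
have [Q [QQ QA]] := IH _ _ A's cA'.
pose P : 'M[R]_(1 + n) := block_mx 1%:M 0 0 Q.
have PP : P *m P^T = 1%:M.
  rewrite /P (@tr_block_mx _ 1 n 1 n) mulmx_block !trmx0 !mulmx0 !mul0mx trmx1 mulmx1.
  by rewrite !addr0 add0r QQ -scalar_mx_block.
pose D : 'M[R]_(1 + n) := block_mx (lam ord0)%:M 0 0 (diag_mx (\row_i lam (lift ord0 i))).
have PB : P *m block_mx (lam ord0)%:M 0 0 A' = D *m P.
  by rewrite !mulmx_block !mulmx0 !mul0mx !addr0 !add0r mul1mx mulmx1 QA.
have DE : diag_mx (\row_i lam i) = D.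
  have -> : (\row_i lam i) = row_mx (lam ord0)%:M (\row_i lam (lift ord0 i)) :> 'rV[R]_(1 + n).
    apply: etrans (esym (@hsubmxK _ 1 1 n _)) _; congr (@row_mx R 1 1 n _ _);
      apply/rowP => i; rewrite !mxE ?(ord1 i) ?eqxx ?mulr1n; congr lam; exact: val_inj.
  apply: etrans (@diag_mx_row R n 1 _ _) _; congr (@block_mx R 1 n 1 n _ _ _ _).
  by apply/matrixP => i j; rewrite !mxE !ord1 eqxx.
have HA : H *m A = B *m H by rewrite BH -mulmxA (mulmx1C HH) mulmx1.
exists (P *m H : 'M[R]_(n.+1)); split.
  by rewrite trmx_mul mulmxA -(mulmxA _ H) HH mulmx1.
by rewrite DE mulmxA -PB -BE -!mulmxA HA.
Qed.

End SpectralTheorem.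

(** * Min-max bounds for the eigenvalue of second largest absolute value *)

Section SecondEigenvalue.
Variable R : realType.

Lemma spectral_coordinates n (A : 'M[R]_n) (lam : 'I_n -> R) : A^T = A ->
  char_poly A = \prod_(i < n) ('X - (lam i)%:P) ->
  exists Q : 'M[R]_n, [/\ forall x, dotv (Q *m x) (Q *m x) = dotv x x,
    forall x, dotv (A *m x) (A *m x) = \sum_i lam i ^+ 2 * (Q *m x) i ord0 ^+ 2
    & forall c : 'cV[R]_n, exists x : 'cV[R]_n, Q *m x = c].
Proof.
move=> As cA; have [Q [QQ QA]] := symmetric_spectral As cA.
have iso x : dotv (Q *m x) (Q *m x) = dotv x x.
  by rewrite dotv_mul mulmxA (mulmx1C QQ) mul1mx.
exists Q; split => // [x|c].
  rewrite -iso mulmxA QA -mulmxA mul_diag_mx dotv_sqr; apply: eq_bigr => i _.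
  by rewrite !mxE exprMn.
by exists (Q^T *m c); rewrite mulmxA QQ mul1mx.
Qed.

(** Supplies the dimension count of both min-max arguments: a plane meets every hyperplane
    nontrivially. *)
Lemma nontrivial_kernel2 (u v : R) : exists a b, a * u + b * v = 0 /\ 0 < a ^+ 2 + b ^+ 2.
Proof.
have [->|u0] := eqVneq u 0; first by exists 1, 0; split; [ring|lra].
exists v, (- u); split; first by ring.
by rewrite sqrrN ltr_wpDl ?sqr_ge0 // lt_def sqr_ge0 sqrf_eq0 u0.
Qed.

Variables (n : nat) (A : 'M[R]_n) (lam : 'I_n -> R) (i2 : 'I_n).
Hypotheses (As : A^T = A) (Al : eig_labelling A lam) (i2E : nat_of_ord i2 = 1%N).

(** Courant-Fischer for the square of [A], which suits an ordering by absolute value. Some nonzero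
    vector of the plane has zero first spectral coordinate, and all other coordinates are stretched
    by at most [|lam i2|]. *)
Lemma second_eigenvalue_ge (e1 e2 : 'cV[R]_n) (t : R) : 0 <= t ->
  dotv e1 e1 = 1 -> dotv e2 e2 = 1 -> dotv e1 e2 = 0 ->
  (forall a b x, x = a *: e1 + b *: e2 ->
     t ^+ 2 * dotv x x <= dotv (A *m x) (A *m x)) ->
  t <= `|lam i2|.
Proof.
move=> t0 e11 e22 e12 H; have [cA mono] := Al.
have [Q [iso AE _]] := spectral_coordinates As cA.
have i10 : (0 < n)%N by rewrite (leq_ltn_trans _ (ltn_ord i2)).
pose i1 := Ordinal i10.
have [a [b [ab0 abp]]] := nontrivial_kernel2 ((Q *m e1) i1 ord0) ((Q *m e2) i1 ord0).
pose x := a *: e1 + b *: e2; have Hx := H a b x erefl.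
have Qx : (Q *m x) i1 ord0 = 0 
  by rewrite mulmxDr -!scalemxAr -ab0; move: (Q *m e1) (Q *m e2) => ? ?; rewrite !mxE.
have xx : dotv x x = a ^+ 2 + b ^+ 2.
  by rewrite !dotv_lin (dotvC e2) e11 e22 e12; ring.
rewrite -ler_sqr ?nnegrE // -(ler_pM2r abp) -xx (le_trans Hx) // AE -iso dotv_sqr mulr_sumr.
apply: ler_sum => i _; have [->|ni] := eqVneq i i1; first by rewrite Qx expr0n !mulr0.
rewrite ler_wpM2r ?sqr_ge0 // -[leLHS]real_normK ?num_real // ler_sqr ?nnegrE //.
by apply: mono; rewrite i2E lt0n -val_eqE in ni *.
Qed.

(** The dual half: the span of the first two eigenvectors contains a nonzero vector orthogonal to
    [g], and [A] stretches it by at least [|lam i2|]. *)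
Lemma second_eigenvalue_le (g : 'cV[R]_n) (T : R) : 0 <= T ->
  (forall x, dotv g x = 0 -> dotv (A *m x) (A *m x) <= T ^+ 2 * dotv x x) ->
  `|lam i2| <= T.
Proof.
move=> T0 H; have [cA mono] := Al.
have [Q [iso AE surj]] := spectral_coordinates As cA.
have i10 : (0 < n)%N by rewrite (leq_ltn_trans _ (ltn_ord i2)).
pose i1 := Ordinal i10.
have n12 : i1 != i2 by rewrite -val_eqE /= i2E.
have [q1 Q1] := surj (delta_mx i1 ord0); have [q2 Q2] := surj (delta_mx i2 ord0).
have [a [b [ab0 abp]]] := nontrivial_kernel2 (dotv g q1) (dotv g q2).
pose x := a *: q1 + b *: q2.
have Qx i : (Q *m x) i ord0 = a * (i == i1)%:R + b * (i == i2)%:R.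
  by rewrite mulmxDr -!scalemxAr Q1 Q2 !mxE !andbT.
have xx : 0 < dotv x x.
  apply: dotv_gt0; apply: contraTneq abp => x0.
  have := Qx i1; have := Qx i2; rewrite x0 mulmx0 !mxE !eqxx (negbTE n12) eq_sym (negbTE n12).
  by rewrite !mulr0 !mulr1 addr0 add0r => <- <-; rewrite expr0n addr0 ltxx.
have Hx := H x _; rewrite -ler_sqr ?nnegrE // -(ler_pM2r xx).
apply: le_trans (Hx _); last by rewrite !dotv_lin.
rewrite AE -iso dotv_sqr mulr_sumr; apply: ler_sum => i _.
rewrite Qx.
have h : (i <= i2)%N -> `|lam i2| ^+ 2 <= lam i ^+ 2.
  by move=> /mono h; rewrite -[leRHS]real_normK ?num_real // ler_sqr ?nnegrE.
have [E1|n1] := eqVneq i i1; first by rewrite ler_wpM2r ?sqr_ge0 // h // E1.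
have [E2|n2] := eqVneq i i2; first by rewrite ler_wpM2r ?sqr_ge0 // h // E2.
by rewrite !mulr0 addr0 expr0n !mulr0.
Qed.

End SecondEigenvalue.

(** * Concentration of bilinear forms *)

Section BernoulliMatrices.
Variable R : realType.

(** For [x <= 1/2] compare with 1/(1 - x) <= 1 + x + 2x^2; beyond 1/2, [x] is already below 2x^2. *)
Lemma expR_le_sqr (x : R) : expR x <= x + expR (2 * x ^+ 2).
Proof.
have e1 := expR_ge1Dx (2 * x ^+ 2).
have [x2|x2] := lerP x 2^-1.
  have h : expR x <= (1 - x)^-1.
    rewrite -[x in leLHS]opprK expRN lef_pV2 ?posrE ?expR_gt0 ?expR_ge1Dx //; lra.
  suff : (1 - x)^-1 <= 1 + x + 2 * x ^+ 2 by lra.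
  rewrite -[leLHS]mul1r ler_pdivrMr; last lra.
  nra.
have : expR x <= expR (2 * x ^+ 2) by rewrite ler_expR; nra.
lra.
Qed.

(** In [expR_le_sqr] the linear term averages to zero for a centred variable, and the centred values
    [1 - m] and [- m] lie in [-1, 1]. *)
Lemma bernoulli_mgf_le (m a : R) : 0 <= m <= 1 ->
  m * expR (a * (1 - m)) + (1 - m) * expR (a * - m) <= expR (2 * a ^+ 2).
Proof.
move=> /andP[m0 m1].
have h c : -1 <= c <= 1 -> expR (a * c) <= a * c + expR (2 * a ^+ 2).
  move=> /andP[c0 c1]; apply: le_trans (expR_le_sqr _) _; rewrite lerD2l ler_expR ler_pM2l //.
  rewrite exprMn ler_piMr ?sqr_ge0 //; nra.
have h1 : m * expR (a * (1 - m)) <= m * (a * (1 - m) + expR (2 * a ^+ 2)).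
  by rewrite ler_wpM2l // h //; lra.
have h2 : (1 - m) * expR (a * - m) <= (1 - m) * (a * - m + expR (2 * a ^+ 2)).
  by rewrite ler_wpM2l ?h //; lra.
apply: le_trans (lerD h1 h2) _; rewrite le_eqVlt; apply/orP; left; apply/eqP; ring.
Qed.

Variable n : nat.
Implicit Types (m : 'M[R]_n) (w : 'M[bool]_n).

(** Independence: the expectation of a product over entries is the product of the expectations. *)
Lemma weight_expectation m (phi : 'I_n -> 'I_n -> bool -> R) :
  \sum_w weight m w * (\prod_(i < n) \prod_(j < n | (i < j)%N) phi i j (w i j)) =
  \prod_(i < n) \prod_(j < n | (i < j)%N)
     (m i j * phi i j true + (1 - m i j) * phi i j false).
Proof.
(* Outside the strict upper triangle the factor forces [false]; this absorbs [upper_only] and sums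
   to 1 over the two values. *)
pose g (ij : 'I_n * 'I_n) (b : bool) : R :=
  if (ij.1 < ij.2)%N then (if b then m ij.1 ij.2 else 1 - m ij.1 ij.2) * phi ij.1 ij.2 b
  else (~~ b)%:R.
transitivity (\sum_(w : 'M[bool]_n) \prod_(ij : 'I_n * 'I_n) g ij (w ij.1 ij.2)).
  apply: eq_bigr => w _; rewrite /weight -mulrA -big_split /=.
  under [X in _ * X]eq_bigr do rewrite -big_split /=.
  rewrite -(pair_bigA _ (fun i j => g (i, j) (w i j))) /=.
  under [RHS]eq_bigr => i _ do rewrite (bigID (fun j : 'I_n => (i < j)%N)) /=.
  rewrite [RHS]big_split /= [RHS]mulrC; congr (_ * _).
    case: (boolP (upper_only w)) => [/forallP up|].
      rewrite big1 // => i _; rewrite big1 // => j /negbTE ij; rewrite /g /= ij.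
      by move/forallP/(_ j): (up i); rewrite ij implybF => ->.
    rewrite negb_forall => /existsP[i]; rewrite negb_forall => /existsP[j].
    rewrite negb_imply => /andP[wij ij].
    by rewrite (bigD1 i) //= (bigD1 j) //= /g /= (negbTE ij) wij !mul0r.
  by apply: eq_bigr => i _; apply: eq_bigr => j ij; rewrite /g /= ij.
(* Outcomes become functions on index pairs, so that the sum of products distributes into a product
   of sums. *)
pose F (f : {ffun 'I_n * 'I_n -> bool}) : 'M[bool]_n := \matrix_(i, j) f (i, j).
rewrite (reindex F) /=; last first.
  exists (fun w : 'M[bool]_n => [ffun ij => w ij.1 ij.2]) => [f _|w _].
    by apply/ffunP => -[i j]; rewrite ffunE mxE.
  by apply/matrixP => i j; rewrite mxE ffunE.
transitivity (\sum_(f : {ffun 'I_n * 'I_n -> bool}) \prod_ij g ij (f ij)).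
  by apply: eq_bigr => f _; apply: eq_bigr => -[i j] _; rewrite mxE.
rewrite -(bigA_distr_bigA g) -(pair_bigA _ (fun i j => \sum_b g (i, j) b)) /=.
apply: eq_bigr => i _; rewrite [RHS]big_mkcond /=; apply: eq_bigr => j _.
by rewrite big_bool /g /=; case: ifP => _ //=; rewrite add0r.
Qed.

Lemma weight_total m : \sum_w weight m w = 1.
Proof.
have := weight_expectation m (fun _ _ _ => 1).
rewrite (eq_bigr (weight m)) => [->|w _]; last first.
  by rewrite big1 ?mulr1 // => i _; rewrite big1.
rewrite big1 // => i _; rewrite big1 // => j _; ring.
Qed.

Lemma weight_ge0 m w : (forall i j, 0 <= m i j <= 1) -> 0 <= weight m w.
Proof.
move=> h; rewrite mulr_ge0 ?ler0n //; apply: prodr_ge0 => i _; apply: prodr_ge0 => j _.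
by have /andP[] := h i j; case: ifP => _; lra.
Qed.

Variable m : 'M[R]_n.
Hypotheses (m01 : forall i j, 0 <= m i j <= 1) (mT : m^T = m) (mdiag : forall i, m i i = 0).

(** Folding the lower triangle onto the upper one leaves a sum of independent terms. *)
Lemma bilinear_deviation w (x y : 'cV[R]_n) :
  dotv x ((Mhat R w - m) *m y) =
  \sum_(i < n) \sum_(j < n | (i < j)%N)
     ((w i j)%:R - m i j) * (x i ord0 * y j ord0 + x j ord0 * y i ord0).
Proof.
pose D i j := ((w i j)%:R - m i j).
have mS i j : m i j = m j i by rewrite -[in LHS]mT mxE.
transitivity (\sum_(i < n) (\sum_(j : 'I_n | (i < j)%N) D i j * (x i ord0 * y j ord0)
    + \sum_(j : 'I_n | (j < i)%N) D j i * (x i ord0 * y j ord0))).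
  apply: eq_bigr => i _; rewrite mxE mulr_sumr (bigID (fun j : 'I_n => (i < j)%N)) /=.
  congr (_ + _); first by apply: eq_bigr => j ij; rewrite !mxE ij /D; ring.
  rewrite [LHS]big_mkcond [RHS]big_mkcond /=; apply: eq_bigr => j _.
  rewrite -leqNgt leq_eqVlt; case: ltngtP => //= [ji|/val_inj ->]; last first.
    by rewrite !mxE ltnn mdiag subrr mul0r mulr0.
  by rewrite !mxE ltnNge ltnW //= ji /D (mS i j); ring.
rewrite big_split /= [X in _ + X](exchange_big_dep xpredT) //= -big_split /=.
by apply: eq_bigr => i _; rewrite -big_split /=; apply: eq_bigr => j _; rewrite /D; ring.
Qed.

(** Markov's inequality for the exponential moment, which factors by independence. The 4 is the 2 of
    [bernoulli_mgf_le] times the 2 of (a + b)^2 <= 2 (a^2 + b^2). *)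
Lemma chernoff_bilinear (x y : 'cV[R]_n) (l T : R) : 0 <= l ->
  \sum_(w | T < dotv x ((Mhat R w - m) *m y)) weight m w <=
  expR (4 * l ^+ 2 * (dotv x x * dotv y y) - l * T).
Proof.
move=> l0.
pose c i j := x i ord0 * y j ord0 + x j ord0 * y i ord0.
apply: (@le_trans _ _ (\sum_w weight m w *
   expR (l * dotv x ((Mhat R w - m) *m y) - l * T))).
  rewrite big_mkcond; apply: ler_sum => w _; have w0 := weight_ge0 w m01.
  case: ifP => h; last by rewrite mulr_ge0 ?expR_ge0.
  rewrite ler_peMr // -expR0 ler_expR subr_ge0 ler_wpM2l // ltW //.
under eq_bigr do rewrite expRD mulrA.
rewrite -mulr_suml expRD ler_wpM2r ?expR_ge0 //.
pose phi i j (b : bool) := expR (l * c i j * (b%:R - m i j)).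
have -> : \sum_w weight m w * expR (l * dotv x ((Mhat R w - m) *m y)) =
  \sum_w weight m w * (\prod_(i < n) \prod_(j < n | (i < j)%N) phi i j (w i j)).
  apply: eq_bigr => w _; congr (_ * _); rewrite bilinear_deviation mulr_sumr expR_sum.
  apply: eq_bigr => i _; rewrite mulr_sumr expR_sum; apply: eq_bigr => j _.
  by rewrite /phi /c; congr expR; ring.
rewrite weight_expectation.
apply: (@le_trans _ _ (\prod_(i < n) \prod_(j < n | (i < j)%N) expR (2 * (l * c i j) ^+ 2))).
  apply: ler_prod => i _; apply/andP; split.
    apply: prodr_ge0 => j _; have /andP[m0 m1] := m01 i j.
    by rewrite addr_ge0 // mulr_ge0 ?expR_ge0 // subr_ge0.
  apply: ler_prod => j _; have /andP[m0 m1] := m01 i j; apply/andP; split.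
    by rewrite addr_ge0 // mulr_ge0 ?expR_ge0 // subr_ge0.
  by rewrite /phi sub0r; exact: bernoulli_mgf_le.
under eq_bigr do rewrite -expR_sum.
rewrite -expR_sum ler_expR.
pose q i j := (x i ord0 * y j ord0) ^+ 2.
have -> : dotv x x * dotv y y = \sum_i \sum_j q i j.
  rewrite !dotv_sqr mulr_suml; apply: eq_bigr => i _; rewrite mulr_sumr.
  by apply: eq_bigr => j _; rewrite /q exprMn.
apply: (@le_trans _ _ (\sum_(i < n) \sum_(j < n | (i < j)%N) 4 * l ^+ 2 * (q i j + q j i))).
  apply: ler_sum => i _; apply: ler_sum => j _.
  rewrite /c /q -subr_ge0.
  rewrite [X in 0 <= X](_ : _ =
    2 * (l * (x i ord0 * y j ord0 - x j ord0 * y i ord0)) ^+ 2); last by ring.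
  by rewrite mulr_ge0 ?sqr_ge0.
under eq_bigr do rewrite -mulr_sumr.
rewrite -mulr_sumr ler_wpM2l ?mulr_ge0 ?sqr_ge0 //.
under eq_bigr do rewrite big_split /=.
rewrite big_split /= [X in _ + X](exchange_big_dep xpredT) //= -big_split /=.
apply: ler_sum => i _; rewrite [leRHS](bigID (fun j : 'I_n => (i < j)%N)) /= lerD2l.
rewrite big_mkcond [leRHS]big_mkcond /=; apply: ler_sum => j _.
by case: ltngtP => //= _; rewrite /q sqr_ge0.
Qed.

End BernoulliMatrices.

(** * Operator norm from a lattice net *)

Section IntegerNet.
Variables (R : realType) (n : nat).
Hypothesis n_gt0 : (0 < n)%N.

(* Integer vectors, coordinatewise as a sign and an absolute value; zero coordinates are encoded
   twice, which only loosens the union bound. *)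
Definition lattice_point := {ffun 'I_n -> bool * 'I_(4 * n).+1}.

Definition lattice_vec (f : lattice_point) : 'cV[R]_n :=
  \col_i ((-1) ^+ (f i).1 * ((f i).2 : nat)%:R).

(** Divided by 4 sqrt n, these points lie in the unit ball and, by [net_rounding], come within 1/4
    of each of its points. *)
Definition in_net (f : lattice_point) : bool := (\sum_i (f i).2 ^ 2 <= 16 * n)%N.

Lemma lattice_vec_norm f : in_net f -> dotv (lattice_vec f) (lattice_vec f) <= 16 * n%:R.
Proof.
rewrite /in_net -(ler_nat R) natrM => h; apply: le_trans h.
rewrite dotv_sqr natr_sum; apply: ler_sum => i _.
by rewrite mxE exprMn sqrr_sign mul1r natrX.
Qed.

Lemma sum_geometric_half N : \sum_(k < N) (2^-1 : R) ^+ k <= 2.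
Proof.
suff : \sum_(k < N) (2^-1 : R) ^+ k <= 2 - 2 * 2^-1 ^+ N.
  by move=> h; apply: le_trans h _; rewrite gerBl mulr_ge0 ?exprn_ge0.
elim: N => [|N IH]; first by rewrite big_ord0 expr0; lra.
rewrite big_ord_recr /= exprS; move: IH; move: (\sum_(i < N) _) (2^-1 ^+ N) => u v; lra.
Qed.

(** Each net point has |f_1| + ... + |f_n| <= 16n, so weighting by 2^(16n - sum |f_i|) only
    overcounts. The weights factor over coordinates, each contributing at most 2 * 2 = 4 (two signs,
    a geometric series). *)
Lemma card_net : (#|[set f | in_net f]|)%:R <= (2 : R) ^+ (18 * n).
Proof.
rewrite -sum1_card natr_sum.
pose g (bk : bool * 'I_(4 * n).+1) : R := 2^-1 ^+ bk.2.
apply: (@le_trans _ _ (\sum_(f : lattice_point) 2 ^+ (16 * n) * \prod_i g (f i))).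
  rewrite big_mkcond; apply: ler_sum => f _.
  have g0 : 0 <= \prod_i g (f i) by apply: prodr_ge0 => i _; rewrite exprn_ge0.
  case: ifP => [|_]; last by rewrite mulr_ge0 ?exprn_ge0.
  rewrite inE /in_net => fn.
  rewrite /g prodrXr exprVn ler_pdivlMr ?exprn_gt0 // mul1r.
  rewrite ler_eXn2l ?ltr1n //; apply: leq_trans fn; apply: leq_sum => i _.
  by rewrite -[X in (X <= _)%N]expn1; case: (nat_of_ord _) => // k; rewrite leq_pexp2l.
rewrite -mulr_sumr -(bigA_distr_bigA (fun=> g)) /= prodr_const card_ord.
have -> : (18 * n = 16 * n + 2 * n)%N by rewrite -mulnDl.
rewrite exprD ler_wpM2l ?exprn_ge0 // exprM lerXn2r ?nnegrE ?sumr_ge0 // => [bk _|].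
  by rewrite exprn_ge0.
rewrite -(pair_bigA _ (fun b k => g (b, k))) /= big_bool /g /=.
by have := sum_geometric_half (4 * n).+1; lra.
Qed.

(* Truncation towards zero does not increase norms. *)
Lemma net_rounding (x : 'cV[R]_n) : dotv x x <= 1 ->
  exists2 f, in_net f &
  let r := 4 * Num.sqrt n%:R *: x - lattice_vec f in dotv r r <= n%:R.
Proof.
move=> x1; set r := Num.sqrt n%:R.
have n1 : 1 <= n%:R :> R by rewrite ler1n.
have r0 : 0 <= r by exact: sqrtr_ge0.
have rr : r ^+ 2 = n%:R by rewrite sqr_sqrtr ?ler0n.
have rn : r <= n%:R by rewrite -rr; nra.
have xi i : `|x i ord0| <= 1.
  rewrite -ler_sqr ?nnegrE // expr1n real_normK ?num_real //; apply: le_trans x1.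
  by rewrite dotv_sqr (bigD1 i) //= lerDl sumr_ge0 // => j _; rewrite sqr_ge0.
pose a i := 4 * r * `|x i ord0|.
have a0 i : 0 <= a i by rewrite !mulr_ge0.
have tr i : (Num.truncn (a i))%:R <= a i < (Num.truncn (a i)).+1%:R by exact: truncn_itv.
(* Since 4 sqrt n <= 4n, the truncated values fit the index range of [lattice_point]. *)
have tle i : (Num.truncn (a i) < (4 * n).+1)%N.
  have /andP[t1 _] := tr i; rewrite ltnS -(ler_nat R) (le_trans t1) // natrM /a.
  by have := xi i; have := normr_ge0 (x i ord0); nra.
exists [ffun i => (x i ord0 < 0, Ordinal (tle i))].
  rewrite /in_net -(ler_nat R) natr_sum natrM.
  apply: (@le_trans _ _ (\sum_i 16 * n%:R * x i ord0 ^+ 2)); last first.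
    by rewrite -mulr_sumr -dotv_sqr ler_piMr.
  apply: ler_sum => i _; rewrite ffunE /= natrX.
  have /andP[t1 _] := tr i.
  have -> : 16 * n%:R * x i ord0 ^+ 2 = a i ^+ 2.
    by rewrite /a -rr -[x i ord0 ^+ 2]real_normK ?num_real //; ring.
  by rewrite ler_sqr ?nnegrE.
rewrite /= dotv_sqr.
have -> : n%:R = \sum_(i < n) 1 :> R by rewrite sumr_const card_ord.
apply: ler_sum => i _; rewrite !mxE ffunE /=.
have /andP[t1 t2] := tr i; rewrite -natr1 in t2.
set t := (Num.truncn _)%:R in t1 t2 *.
have -> : 4 * r * x i ord0 - (-1) ^+ (x i ord0 < 0)%R * t =
    (-1) ^+ (x i ord0 < 0)%R * (a i - t).
  rewrite /a; case: ltP => h; [rewrite ltr0_norm|rewrite ger0_norm] => //=; ring.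
rewrite exprMn sqrr_sign mul1r; nra.
Qed.

End IntegerNet.

Section OperatorNorm.
Variables (R : realType) (n : nat).
Hypothesis n_gt0 : (0 < n)%N.
Let r : R := Num.sqrt n%:R.

(** With [B] the supremum over the unit ball, rounding both arguments to the net gives
    [B <= K + B / 4 + B / 4], hence [B <= 2 * K]. *)
Lemma operator_norm_from_net (E : 'M[R]_n) (K : R) : 0 <= K ->
  (forall f g : lattice_point n, in_net f -> in_net g ->
     dotv (lattice_vec R f) (E *m lattice_vec R g) <= 16 * n%:R * K) ->
  forall x y, `|dotv x (E *m y)| <= 2 * K * (vnorm x * vnorm y).
Proof.
move=> K0 H.
have n1 : 0 < n%:R :> R by rewrite ltr0n.
have r0 : 0 < r by rewrite sqrtr_gt0.
have rr : r ^+ 2 = n%:R by rewrite sqr_sqrtr ?ler0n.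
pose S : set R := [set t | exists x y : 'cV[R]_n,
  [/\ dotv x x <= 1, dotv y y <= 1 & t = dotv x (E *m y)]]%classic.
pose F := \sum_i \sum_j E i j ^+ 2.
have hS : has_sup S.
  split; first by exists 0; exists 0, 0; split; rewrite ?dotv0 // dotvC dotv0.
  (* This crude Frobenius bound serves only to make the supremum finite. *)
  exists (F + 1) => _ [x [y [x1 y1 ->]]].
  have F0 : 0 <= F by apply: sumr_ge0 => i _; apply: sumr_ge0 => j _; rewrite sqr_ge0.
  have := cauchy_schwarz_sqr x (E *m y); have := vnorm_mul_le_frobenius E y; rewrite -/F.
  have := dotv_ge0 x; have := dotv_ge0 y; have := dotv_ge0 (E *m y).
  move: (dotv (E *m y) (E *m y)) (dotv x x) (dotv y y) (dotv x (E *m y)) x1 y1.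
  move=> p q s t *; have : t ^+ 2 <= F by nra.
  move=> ?; nra.
pose B := sup S.
have leB x y : dotv x x <= 1 -> dotv y y <= 1 -> dotv x (E *m y) <= B.
  by move=> x1 y1; apply: ub_le_sup; [case: hS|exists x, y].
have round x : dotv x x <= 1 -> exists f, exists2 d : 'cV[R]_n, in_net f &
    dotv d d <= 1 /\ x = (4 * r)^-1 *: lattice_vec R f + 4^-1 *: d.
  move=> x1; have [f fn fr] := net_rounding n_gt0 x1.
  exists f, (r^-1 *: (4 * r *: x - lattice_vec R f)) => //; split.
    rewrite dotvZl dotvZr mulrA -invfM -expr2 rr ler_pdivrMl // mulr1; exact: fr.
  rewrite scalerA -invfM scalerBr scalerA mulVf ?mulf_neq0 ?lt0r_neq0 //.
  by rewrite scale1r addrC subrK.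
have ball (f : lattice_point n) : in_net f ->
    dotv ((4 * r)^-1 *: lattice_vec R f) ((4 * r)^-1 *: lattice_vec R f) <= 1.
  move=> /(lattice_vec_norm R) h; rewrite dotvZl dotvZr mulrA -invfM -expr2 exprMn rr.
  by rewrite ler_pdivrMl ?mulr1 ?mulr_gt0 ?exprn_gt0 // (le_trans h) // -natrX.
have step x y : dotv x x <= 1 -> dotv y y <= 1 -> dotv x (E *m y) <= K + B / 2.
  move=> x1 y1; have [f [d fn [d1 xE]]] := round x x1; have [g [e gn [e1 yE]]] := round y y1.
  (* Rounding [y] only where [x] is already rounded leaves two remainders, each 1/4 times a value
     bounded by [B]. *)
  rewrite xE dotvDl [X in X + _](_ : _ = dotv ((4 * r)^-1 *: lattice_vec R f)
     (E *m ((4 * r)^-1 *: lattice_vec R g)) +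
     4^-1 * dotv ((4 * r)^-1 *: lattice_vec R f) (E *m e)); last first.
    by rewrite yE mulmxDr dotvDr -[E *m (4^-1 *: e)]scalemxAr (dotvZr 4^-1).
  have h1 := leB _ e (ball f fn) e1.
  have h2 := leB d y d1 y1.
  have h3 : dotv ((4 * r)^-1 *: lattice_vec R f) (E *m ((4 * r)^-1 *: lattice_vec R g)) <= K.
    rewrite -scalemxAr dotvZl dotvZr mulrA -invfM -expr2 exprMn rr.
    rewrite ler_pdivrMl ?mulr_gt0 ?exprn_gt0 //.
    by rewrite (_ : 4 ^+ 2 = 16) ?H // -natrX.
  rewrite (dotvZl 4^-1); lra.
have B2 : B <= 2 * K.
  have : B <= K + B / 2 by apply: ge_sup => [|_ [x [y [x1 y1 ->]]]]; [case: hS|exact: step].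
  lra.
have le1 x y : dotv x (E *m y) <= 2 * K * (vnorm x * vnorm y).
  have [->|x0] := eqVneq x 0; first by rewrite dotvC dotv0 !mulr_ge0 ?vnorm_ge0.
  have [->|y0] := eqVneq y 0; first by rewrite mulmx0 dotv0 !mulr_ge0 ?vnorm_ge0.
  have px : 0 < vnorm x by rewrite sqrtr_gt0 dotv_gt0.
  have py : 0 < vnorm y by rewrite sqrtr_gt0 dotv_gt0.
  have unit z : 0 < vnorm z -> dotv ((vnorm z)^-1 *: z) ((vnorm z)^-1 *: z : 'cV[R]_n) <= 1.
    move=> pz; rewrite dotvZl dotvZr mulrA -sqr_vnorm -invfM -expr2 mulVf //.
    by rewrite expf_neq0 ?lt0r_neq0.
  have := le_trans (leB _ _ (unit x px) (unit y py)) B2.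
  by rewrite -scalemxAr dotvZl dotvZr mulrA -invfM ler_pdivrMl ?mulr_gt0 // [X in _ <= X]mulrC.
move=> x y; rewrite ler_norml le1 andbT lerNl -dotvNl -[vnorm x]vnormN; exact: le1.
Qed.

End OperatorNorm.

(** * Union bound over pairs of net points *)

Section NormEvent.
Variables (R : realType) (n : nat) (m : 'M[R]_n).
Hypotheses (n_gt0 : (0 < n)%N) (m01 : forall i j, 0 <= m i j <= 1) (mT : m^T = m)
  (mdiag : forall i, m i i = 0).

(** At most 2^(36n) pairs of net points, each failing with probability at most 2^(-96n). *)
Lemma operator_norm_event : exists G : {set 'M[bool]_n},
  1 - (n%:R ^+ 3)^-1 <= \sum_(w in G) weight m w /\
  forall w, w \in G -> forall x y,
    `|dotv x ((Mhat R w - m) *m y)| <= 140 * Num.sqrt n%:R * (vnorm x * vnorm y).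
Proof.
set r := Num.sqrt n%:R.
have n1 : 0 < n%:R :> R by rewrite ltr0n.
have r0 : 0 < r by rewrite sqrtr_gt0.
have rr : r ^+ 2 = n%:R by rewrite sqr_sqrtr ?ler0n.
(* The threshold required by [operator_norm_from_net] with [K = 70 * r]. *)
pose T := 16 * n%:R * (70 * r).
pose q (f g : lattice_point n) (w : 'M[bool]_n) :=
  dotv (lattice_vec R f) ((Mhat R w - m) *m lattice_vec R g).
exists [set w | [forall f, forall g, [==> in_net f, in_net g => q f g w <= T]]]; split; last first.
  move=> w; rewrite inE => /forallP h x y.
  have -> : 140 * r = 2 * (70 * r) by ring.
  apply: operator_norm_from_net => //; first by rewrite mulr_ge0 // ltW.
  by move=> f g fn gn; have /forallP/(_ g) := h f; rewrite fn gn.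
set G := finset _.
have -> : \sum_(w in G) weight m w = 1 - \sum_(w | w \notin G) weight m w.
  by rewrite -(weight_total m) [in RHS](bigID (mem G)) /= addrK.
rewrite lerD2l lerN2.
pose Net : {set lattice_point n} := [set f | in_net f].
have small f g : f \in Net -> g \in Net ->
    \sum_(w | T < q f g w) weight m w <= (2 ^+ (96 * n))^-1.
  rewrite !inE => fn gn.
  have rV : 0 <= r^-1 by rewrite invr_ge0 ltW.
  (* With [l = 1 / r] the exponent is at most 1024n - 1120n = -96n; then [expR 1 >= 2]. *)
  apply: le_trans (chernoff_bilinear m01 mT mdiag _ _ _ rV) _.
  apply: (@le_trans _ _ (expR (- (96 * n)%:R))).
    rewrite ler_expR natrM.
    have := lattice_vec_norm R fn; have := lattice_vec_norm R gn.
    have := dotv_ge0 (lattice_vec R f); have := dotv_ge0 (lattice_vec R g).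
    move: (dotv (lattice_vec R f) _) (dotv (lattice_vec R g) _) => a b a0 b0 a1 b1.
    have ab : a * b <= (16 * n%:R) * (16 * n%:R) by rewrite ler_pM.
    have -> : r^-1 * T = 1120 * n%:R by rewrite /T; field; rewrite lt0r_neq0.
    have h : 4 * r^-1 ^+ 2 * (a * b) <= 4 * r^-1 ^+ 2 * ((16 * n%:R) * (16 * n%:R)).
      by rewrite ler_wpM2l ?mulr_ge0 ?sqr_ge0.
    rewrite exprVn rr in h *.
    have E : 4 * n%:R^-1 * (16 * n%:R * (16 * n%:R)) = 1024 * n%:R :> R.
      by field; rewrite lt0r_neq0.
    rewrite E in h; lra.
  rewrite expRN lef_pV2 ?posrE ?expR_gt0 ?exprn_gt0 // -[X in expR X]mulr1 expRM_natl.
  by rewrite lerXn2r ?nnegrE ?expR_ge0 // (le_trans _ (expR_ge1Dx _)) //; lra.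
apply: (@le_trans _ _ (\sum_(f in Net) \sum_(g in Net) \sum_(w | T < q f g w) weight m w)).
  under [leRHS]eq_bigr do rewrite (exchange_big_dep xpredT) //=.
  rewrite [leRHS](exchange_big_dep xpredT) //= big_mkcond; apply: ler_sum => w _.
  have w0 := weight_ge0 w m01.
  have s0 (f : lattice_point n) : 0 <= \sum_(g in Net | T < q f g w) weight m w.
    by apply: sumr_ge0.
  case: ifP => [|_]; last by apply: sumr_ge0 => f _; exact: s0.
  rewrite inE negb_forall => /existsP[f]; rewrite negb_forall => /existsP[g].
  rewrite !negb_imply -ltNge => /and3P[fn gn fgT].
  rewrite (bigD1 f) ?inE ?fn //= (bigD1 g) ?inE ?gn //= -addrA lerDl.
  by rewrite addr_ge0 ?sumr_ge0 //.
apply: (@le_trans _ _ (\sum_(f in Net) \sum_(g in Net) (2 ^+ (96 * n))^-1)).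
  by apply: ler_sum => f fn; apply: ler_sum => g gn; exact: small.
move: (card_net R n) => c2; rewrite -/Net in c2; rewrite !sumr_const -mulrnA.
rewrite -[_ *+ (_ * _)]mulr_natl natrM.
rewrite ler_pdivrMr ?exprn_gt0 // [leRHS]mulrC ler_pdivlMr ?exprn_gt0 //.
(* Two net cardinalities and n^3 <= 2^(3n); the exponents add up to 39n <= 96n. *)
apply: (@le_trans _ _ (2 ^+ (18 * n) * 2 ^+ (18 * n) * 2 ^+ (3 * n))).
  apply: ler_pM; rewrite ?mulr_ge0 ?ler0n ?exprn_ge0 //.
    by rewrite ler_pM ?ler0n.
  rewrite mulnC exprM lerXn2r ?nnegrE ?exprn_ge0 ?ler0n // -natrX ler_nat ltnW // ltn_expl //.
rewrite -!exprD -!mulnDl ler_eXn2l ?ltr1n //; exact: leq_mul.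
Qed.

End NormEvent.

(** * Perturbation of the second eigenvector *)

Section Frobenius.
Variables (R : realType) (n : nat).
Implicit Types (X Y Z : 'M[R]_n) (a b c : 'cV[R]_n).

Definition frob X Y : R := \sum_i \sum_j X i j * Y i j.

Lemma frobC X Y : frob X Y = frob Y X.
Proof. by apply: eq_bigr => i _; apply: eq_bigr => j _; rewrite mulrC. Qed.

Lemma frobBr X Y Z : frob X (Y - Z) = frob X Y - frob X Z.
Proof.
rewrite /frob -sumrB; apply: eq_bigr => i _; rewrite -sumrB.
by apply: eq_bigr => j _; rewrite !mxE mulrBr.
Qed.

Lemma frobZr k X Y : frob X (k *: Y) = k * frob X Y.
Proof.
rewrite /frob mulr_sumr; apply: eq_bigr => i _; rewrite mulr_sumr.
by apply: eq_bigr => j _; rewrite !mxE; ring.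
Qed.

Lemma frob_outer X a b : frob X (a *m b^T) = dotv a (X *m b).
Proof.
apply: eq_bigr => i _; rewrite mxE mulr_sumr; apply: eq_bigr => j _.
by rewrite mxE big_ord1 mxE; ring.
Qed.

Lemma frob_ge0 X : 0 <= frob X X.
Proof. by apply: sumr_ge0 => i _; apply: sumr_ge0 => j _; rewrite -expr2 sqr_ge0. Qed.

Lemma dotv_mul_le_frob X a : dotv (X *m a) (X *m a) <= frob X X * dotv a a.
Proof.
apply: le_trans (vnorm_mul_le_frobenius X a) _.
by rewrite /frob; under eq_bigr do under eq_bigr do rewrite expr2.
Qed.

Lemma outer_mulmx a b c : a *m b^T *m c = dotv b c *: a.
Proof. by rewrite -mulmxA [X in _ *m X]mx11_scalar mul_mx_scalar -dotvE. Qed.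

End Frobenius.

(** * Deflation of a symmetric matrix and its spectral gap *)

Section Perturbation.
Variables (R : realType) (n : nat) (B : 'M[R]_n) (u e f : 'cV[R]_n) (mu rho : R).
Hypotheses (BT : B^T = B) (uu : dotv u u = 1) (ee : dotv e e = 1) (ue : dotv u e = 0).
Hypotheses (Bu : B *m u = mu *: u) (Be : B *m e = rho *: e + f) (ef : dotv e f = 0).

Let uf : dotv u f = 0.
Proof.
have : dotv u (B *m e) = 0 by rewrite dotvC dotv_mul BT Bu dotvZr dotvC ue mulr0.
by rewrite Be dotvDr dotvZr ue mulr0 add0r.
Qed.

(** The compression of [B] to the orthogonal complement of [u] and [e]; the cross terms with [f] are
    there because [e] is not an eigenvector. *)
Definition deflation : 'M[R]_n :=
  B - mu *: (u *m u^T) - rho *: (e *m e^T) - e *m f^T - f *m e^T.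

Let deflationE x : deflation *m x =
  B *m x - (mu * dotv u x) *: u - (rho * dotv e x) *: e - dotv f x *: e - dotv e x *: f.
Proof. by rewrite /deflation !mulmxBl -!scalemxAl !outer_mulmx !scalerA. Qed.

Let deflationT : deflation^T = deflation.
Proof.
rewrite /deflation; apply/matrixP => i j.
rewrite !mxE !big_ord1 !mxE (_ : B j i = B i j); first by ring.
by rewrite -[in LHS]BT mxE.
Qed.

Let deflation_u : deflation *m u = 0.
Proof.
by rewrite deflationE Bu uu (dotvC e) ue (dotvC f) uf !mulr0 !scale0r mulr1 !subr0 subrr.
Qed.

Let deflation_e : deflation *m e = 0.
Proof.
rewrite deflationE Be ue ee (dotvC f) ef mulr0 !scale0r mulr1 scale1r !subr0.
by rewrite (addrC (_ *: _)) addrK subrr.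
Qed.

Let dot_u_deflation x : dotv u (deflation *m x) = 0.
Proof. by rewrite dotvC dotv_mul deflationT deflation_u dotv0. Qed.

Let dot_e_deflation x : dotv e (deflation *m x) = 0.
Proof. by rewrite dotvC dotv_mul deflationT deflation_e dotv0. Qed.

(** The deflation kills [u] and [e] on both sides, so its pairing with itself equals its pairing
    with [B], which is then expanded term by term. *)
Lemma frob_deflation :
  frob deflation deflation = frob B B - mu ^+ 2 - rho ^+ 2 - 2 * dotv f f.
Proof.
transitivity (frob deflation B).
  rewrite {2}/deflation !frobBr !frobZr !frob_outer !deflation_u !deflation_e.
  by rewrite !dotv0 !mulr0 dot_e_deflation !subr0.
rewrite frobC {1}/deflation !frobBr !frobZr !frob_outer Bu Be.
have -> : dotv e (B *m f) = dotv f f.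
  by rewrite dotvC dotv_mul BT Be dotvDr dotvZr (dotvC f) ef mulr0 add0r.
rewrite !dotv_lin uu ee ef (dotvC f e) ef; ring.
Qed.

Section Gap.
Variable S : R.
(** [S] stands for s. The gap rests on 9/20 < 5/8 and 77/100 < 3/2: the deflation lies below [mu],
    and [mu] below [rho]. *)
Hypotheses (S_ge : 100 <= S) (mu_ge : 5 / 8 * S <= mu) (mu_le : mu <= 77 / 100 * S).
Hypotheses (rho_ge : 3 / 2 * S - 2^-1 <= rho) (ff : dotv f f <= S ^+ 2 / 12).
Hypothesis defl_le : frob deflation deflation <= (9 / 20 * S) ^+ 2.

Let S0 : 0 < S. Proof. by apply: lt_le_trans S_ge. Qed.

Let fnorm : vnorm f <= 289 / 1000 * S.
Proof.
rewrite vnorm_le; last by move: S0; lra.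
by have := sqr_ge0 S; move: ff; rewrite exprMn; lra.
Qed.

Let defl_norm x : vnorm (deflation *m x) <= 9 / 20 * S * vnorm x.
Proof.
rewrite vnorm_le; last by rewrite mulr_ge0 ?vnorm_ge0 //; move: S0; lra.
apply: le_trans (dotv_mul_le_frob _ _) _.
by rewrite exprMn sqr_vnorm ler_wpM2r ?dotv_ge0.
Qed.

(** Block form of [B]: the coupling between [e] and the complement passes through [f] alone. *)
Let B_decomp x w : w = x - dotv u x *: u - dotv e x *: e ->
  B *m x = (mu * dotv u x) *: u + (rho * dotv e x + dotv f w) *: e +
           (dotv e x *: f + deflation *m w).
Proof.
move=> wE.
have -> : deflation *m w = deflation *m x.
  by rewrite wE !mulmxBr -!scalemxAr deflation_u deflation_e !scaler0 !subr0.
have -> : dotv f w = dotv f x.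
  by rewrite wE !dotvBr !dotvZr (dotvC f u) uf (dotvC f e) ef !mulr0 !subr0.
by rewrite deflationE; apply/matrixP => i j; rewrite !mxE; ring.
Qed.

Let w_orth x w : w = x - dotv u x *: u - dotv e x *: e ->
  dotv u w = 0 /\ dotv e w = 0.
Proof.
move=> ->; rewrite !dotv_lin uu ee (dotvC e u) ue.
by split; ring.
Qed.

Let pythagoras x w : w = x - dotv u x *: u - dotv e x *: e ->
  dotv x x = dotv u x ^+ 2 + dotv e x ^+ 2 + dotv w w.
Proof.
move=> ->; rewrite !dotv_lin uu ee (dotvC e u) ue (dotvC x u) (dotvC x e); ring.
Qed.

(* [u] and [e] span a plane on which [B] expands by at least [mu], while off [e] it expands by at
   most [mu]; these pin down [|lam i2|] from below and above. *)
Let B_norm_span a b x : x = a *: u + b *: e -> mu * vnorm x <= vnorm (B *m x).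
Proof.
move=> xE; rewrite -ler_sqr ?nnegrE ?mulr_ge0 ?vnorm_ge0 //; last by move: S_ge mu_ge; lra.
rewrite exprMn !sqr_vnorm xE mulmxDr -!scalemxAr Bu Be !dotv_lin uu ee ue.
rewrite (dotvC e u) ue uf (dotvC f u) uf (dotvC f e) ef.
have := dotv_ge0 f; move: (dotv f f) => g g0.
have m2 : mu ^+ 2 <= rho ^+ 2 + g.
  by move: S_ge mu_ge mu_le rho_ge => *; nra.
have : b ^+ 2 * mu ^+ 2 <= b ^+ 2 * (rho ^+ 2 + g) by rewrite ler_wpM2l ?sqr_ge0.
by lra.
Qed.

Let B_norm_orth x : dotv e x = 0 -> vnorm (B *m x) <= mu * vnorm x.
Proof.
move=> ex; rewrite vnorm_le; last by rewrite mulr_ge0 ?vnorm_ge0 //; move: S_ge mu_ge; lra.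
have [w wE] : exists w, w = x - dotv u x *: u - dotv e x *: e by eexists.
have [uw ew] := w_orth wE.
rewrite exprMn sqr_vnorm (B_decomp wE) (pythagoras wE) ex mulr0 add0r scale0r add0r.
rewrite !dotv_lin uu ee ue (dotvC e u) ue dot_u_deflation dot_e_deflation.
rewrite (dotvC (_ *m _) u) dot_u_deflation (dotvC (_ *m _) e) dot_e_deflation.
(* On the part [w] the squared expansion is at most (9/20)^2 + 1/12 times S^2, which is less than
   (5/8)^2 S^2. *)
have h1 := dotv_mul_le_frob deflation w; have h2 := cauchy_schwarz_sqr f w.
have w0 := dotv_ge0 w.
have h3 : frob deflation deflation * dotv w w <= (9 / 20 * S) ^+ 2 * dotv w w by rewrite ler_wpM2r.
have h4 : dotv f f * dotv w w <= S ^+ 2 / 12 * dotv w w by rewrite ler_wpM2r.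
have h5 : (5 / 8 * S) ^+ 2 * dotv w w <= mu ^+ 2 * dotv w w.
  by rewrite ler_wpM2r // ler_sqr ?nnegrE //; move: S_ge mu_ge; lra.
have h6 : 0 <= S ^+ 2 * dotv w w by rewrite mulr_ge0 ?sqr_ge0.
rewrite expr0n /= addr0.
move: h1 h2 h3 h4 h5 h6; move: (dotv w w) (dotv f w) (dotv f f) (dotv u x) => W fw F ux; lra.
Qed.

Variables (A : 'M[R]_n) (p kappa : R).
Hypotheses (AT : A^T = A) (p0 : 0 < p) (kappa_ge0 : 0 <= kappa).
Hypothesis kappa_le : kappa <= p * S / 200.
Hypothesis AB : forall x y, `|dotv x ((A - p *: B) *m y)| <= kappa * (vnorm x * vnorm y).

Let AB_norm x : vnorm ((A - p *: B) *m x) <= kappa * vnorm x.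
Proof.
set E := _ *m x; have := AB E x; rewrite -/E -sqr_vnorm ger0_norm ?sqr_ge0 //.
have [->|E0] := eqVneq (vnorm E) 0; first by rewrite mulr_ge0 ?vnorm_ge0.
have Ep : 0 < vnorm E by rewrite lt_def E0 vnorm_ge0.
by rewrite expr2 mulrCA ler_pM2l.
Qed.

Let AE (x : 'cV[R]_n) : A *m x = p *: (B *m x) + (A - p *: B) *m x.
Proof. by rewrite mulmxBl scalemxAl addrC subrK. Qed.

Variables (lam : 'I_n -> R) (i2 : 'I_n).
Hypotheses (Al : eig_labelling A lam) (i2E : nat_of_ord i2 = 1%N).

(** The plane of [u] and [e] tests the lower bound, the hyperplane orthogonal to [e] the upper one;
    passing from [p *: B] to [A] costs [kappa] in each. *)
Lemma second_eigenvalue_near : p * mu - kappa <= `|lam i2| <= p * mu + kappa.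
Proof.
have mu0 : 5 / 8 * S * p <= p * mu by rewrite [leRHS]mulrC ler_pM2r.
have pS : 0 < p * S by rewrite mulr_gt0.
have t0 : 0 <= p * mu - kappa by move: kappa_le; lra.
have T0 : 0 <= p * mu + kappa by move: kappa_ge0; lra.
apply/andP; split.
  apply: (second_eigenvalue_ge AT Al i2E t0 uu ee ue) => a b x xE.
  rewrite -!sqr_vnorm -exprMn ler_sqr ?nnegrE ?mulr_ge0 ?vnorm_ge0 // AE.
  apply: le_trans (vnormB _ _); rewrite vnormZ gtr0_norm //.
  have := AB_norm x; have := B_norm_span xE => h1 h2.
  have : p * (mu * vnorm x) <= p * vnorm (B *m x) by rewrite ler_pM2l.
  by lra.
apply: (second_eigenvalue_le AT Al i2E T0 (g := e)) => x ex.
rewrite -!sqr_vnorm -exprMn ler_sqr ?nnegrE ?mulr_ge0 ?vnorm_ge0 // AE.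
apply: le_trans (vnormD _ _) _; rewrite vnormZ gtr0_norm //.
have := AB_norm x; have := B_norm_orth ex => h1 h2.
have : p * vnorm (B *m x) <= p * (mu * vnorm x) by rewrite ler_pM2l.
by lra.
Qed.

(** Write y = a u + b e + w and project the residual (pB - A) y onto [e] and onto the complement of
    [u] and [e]. This gives two linear inequalities between |b| and |w|. Only [|lam i2|] enters, so
    its sign is never decided. *)
Lemma second_eigenvector_near (y : 'cV[R]_n) : A *m y = lam i2 *: y ->
  dotv y y = 1 -> 0 <= dotv y u ->
  dotv (y - u) (y - u) <= 1640 * (kappa / (p * S)) ^+ 2.
Proof.
move=> Ay yy yu.
have pS : 0 < p * S by rewrite mulr_gt0.
have /andP[l1 l2] := second_eigenvalue_near.
set l := lam i2 in Ay l1 l2.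
have {}l1 : 62 / 100 * (p * S) <= `|l|.
  have : p * (5 / 8 * S) <= p * mu by rewrite ler_pM2l.
  by move: kappa_le l1; lra.
have {}l2 : `|l| <= 775 / 1000 * (p * S).
  have : p * mu <= p * (77 / 100 * S) by rewrite ler_pM2l.
  by move: kappa_le l2; lra.
have [w wE] : exists w, w = y - dotv u y *: u - dotv e y *: e by eexists.
have [uw ew] := w_orth wE.
set a := dotv u y; set b := dotv e y.
have [d dB] : exists d, d = (p *: B - A) *m y by eexists.
have dn : vnorm d <= kappa.
  have -> : d = - ((A - p *: B) *m y) by rewrite dB -mulNmx opprB.
  by rewrite vnormN (le_trans (AB_norm _)) // {1}/vnorm yy sqrtr1 mulr1.
have [d' d'E] : exists d', d' = (p * b) *: f + p *: (deflation *m w) - l *: w by eexists.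
have dE : d = (p * mu * a - l * a) *: u + (p * rho * b + p * dotv f w - l * b) *: e + d'.
  rewrite dB mulmxBl -scalemxAl Ay (B_decomp wE) -/a -/b d'E.
  have -> : l *: y = l *: (w + a *: u + b *: e) by rewrite wE addrAC !subrK.
  by apply/matrixP => i j; rewrite !mxE; ring.
have ud' : dotv u d' = 0.
  by rewrite d'E !dotv_lin uf dot_u_deflation uw; ring.
have ed' : dotv e d' = 0.
  by rewrite d'E !dotv_lin ef dot_e_deflation ew; ring.
have d'n : vnorm d' <= kappa.
  have h : dotv d d' = dotv d' d' by rewrite dE !dotvDl !dotvZl ud' ed' !mulr0 !add0r.
  have := cauchy_schwarz d d'; rewrite h -sqr_vnorm ger0_norm ?sqr_ge0 // expr2.
  have [->//|d0] := eqVneq (vnorm d') 0.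
  have dp : 0 < vnorm d' by rewrite lt_def d0 vnorm_ge0.
  by rewrite ler_pM2r // => h'; apply: le_trans h' dn.
(* The factor 72/100 is 3/2 - 1/200 - 775/1000, the 1/200 absorbing the [2^-1] in [rho_ge] because
   [S >= 100]. *)
have bound_b : `|b| * (72 / 100 * (p * S)) <= 289 / 1000 * (p * S) * vnorm w + kappa.
  have h : dotv e d = (p * rho - l) * b + p * dotv f w.
    by rewrite dE !dotv_lin ed' ee (dotvC e u) ue; ring.
  have h1 : `|dotv e d| <= kappa.
    have := cauchy_schwarz e d; rewrite {1}/vnorm ee sqrtr1 mul1r => h'; exact: le_trans h' dn.
  have h2 : `|p * dotv f w| <= p * (289 / 1000 * S * vnorm w).
    rewrite normrM gtr0_norm // ler_pM2l // (le_trans (cauchy_schwarz _ _)) //.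
    by rewrite ler_wpM2r ?vnorm_ge0.
  have h3 : `|(p * rho - l) * b| <= kappa + p * (289 / 1000 * S * vnorm w).
    have -> : (p * rho - l) * b = dotv e d - p * dotv f w by rewrite h; ring.
    by apply: le_trans (ler_normB _ _) (lerD h1 h2).
  have h4 : 72 / 100 * (p * S) <= `|p * rho - l|.
    have h5 : p * (3 / 2 * S - 2^-1) <= p * rho by rewrite ler_pM2l.
    have h6 := ler_norm l; have h7 := ler_norm (p * rho - l).
    have h8 : p * 100 <= p * S by rewrite ler_pM2l.
    lra.
  rewrite normrM in h3.
  have : 72 / 100 * (p * S) * `|b| <= `|p * rho - l| * `|b| by rewrite ler_wpM2r.
  lra.
(* The factor 17/100 is 62/100 - 9/20. *)
have bound_w : vnorm w * (17 / 100 * (p * S)) <= 289 / 1000 * (p * S) * `|b| + kappa.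
  have lw : l *: w = (p * b) *: f + p *: (deflation *m w) + - d' by rewrite d'E opprB addrC subrK.
  have : vnorm (l *: w) <= p * `|b| * (289 / 1000 * S) + p * (9 / 20 * S * vnorm w) + kappa.
    rewrite lw; apply: le_trans (vnormD _ _) _; rewrite vnormN lerD //.
    apply: le_trans (vnormD _ _) _; rewrite !vnormZ normrM gtr0_norm // lerD //.
      by rewrite ler_wpM2l ?mulr_ge0 // ltW.
    by rewrite ler_pM2l.
  rewrite vnormZ.
  have : 62 / 100 * (p * S) * vnorm w <= `|l| * vnorm w by rewrite ler_wpM2r ?vnorm_ge0.
  lra.
(* The two bounds close up because 72/100 * 17/100 > (289/1000)^2. *)
pose k := kappa / (p * S).
have kE : kappa = k * (p * S) by rewrite /k divfK ?lt0r_neq0.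
have k0 : 0 <= k by rewrite divr_ge0 // ltW.
have bb : `|b| * (72 / 100) <= 289 / 1000 * vnorm w + k.
  by rewrite -(ler_pM2r pS); move: bound_b; rewrite kE; lra.
have bw : vnorm w * (17 / 100) <= 289 / 1000 * `|b| + k.
  by rewrite -(ler_pM2r pS); move: bound_w; rewrite kE; lra.
have w26 : vnorm w <= 26 * k by lra.
have b12 : `|b| <= 12 * k by lra.
have := pythagoras wE; rewrite -/a -/b yy -sqr_vnorm -[b ^+ 2]real_normK ?num_real //.
rewrite !dotv_lin yy uu (dotvC y u) -/a -/k => P.
rewrite dotvC -/a in yu.
have b2 : `|b| ^+ 2 <= (12 * k) ^+ 2 by rewrite ler_sqr ?nnegrE //; lra.
have w2 : vnorm w ^+ 2 <= (26 * k) ^+ 2 by rewrite ler_sqr ?nnegrE ?vnorm_ge0 //; lra.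
have wb : 0 <= `|b| ^+ 2 + vnorm w ^+ 2 by rewrite addr_ge0 ?sqr_ge0.
(* As 0 <= a <= 1, |y - u|^2 = 2 - 2a <= 2 (1 - a^2) = 2 (b^2 + |w|^2), and 2 (12^2 + 26^2) =
   1640. *)
have a1 : a <= 1 by nra.
nra.
Qed.

End Gap.
End Perturbation.

(** * The expected matrix *)

Section Band.
Variables (R : realType) (s : nat).
Hypothesis s_gt0 : (0 < s)%N.

(** With truncated subtraction the two tests mean |i - j| <= s - 1; the diagonal is included. *)
Definition band : 'M[R]_(2 * s) :=
  \matrix_(i, j) ((i - j <= s - 1) && (j - i <= s - 1))%N%:R.

Lemma bandT : band^T = band.
Proof. by apply/matrixP => i j; rewrite !mxE andbC. Qed.

Lemma Mmat_band p : Mmat s p = p *: (band - 1%:M).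
Proof.
apply/matrixP => i j; rewrite !mxE; have [->|ij] := eqVneq i j; last first.
  by rewrite /= subr0; case: ifP => _; rewrite ?mulr1 ?mulr0.
by rewrite /= !subnn /= subrr mulr0.
Qed.

(** As n = 2s, the band is cut off at one end only in each row: the row is an initial or a final
    segment. *)
Lemma band_sum (g : nat -> R) (i : 'I_(2 * s)) :
  \sum_j band i j * g j =
  if (i < s)%N then \sum_(j < i + s) g j
  else \sum_(j < 2 * s) g j - \sum_(j < i + 1 - s) g j.
Proof.
have i2 := ltn_ord i.
case: ltnP => lis.
  rewrite (@big_ord_widen _ _ _ (i + s) (2 * s) g); last by lia.
  rewrite [RHS]big_mkcond; apply: eq_bigr => j _; rewrite mxE.
  have j2 := ltn_ord j.
  have -> : ((i - j <= s - 1) && (j - i <= s - 1))%N = (j < i + s)%N by lia.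
  by case: ifP; rewrite ?mul1r ?mul0r.
rewrite (@big_ord_widen _ _ _ (i + 1 - s) (2 * s) g); last by lia.
rewrite [X in _ - X]big_mkcond -sumrB; apply: eq_bigr => j _; rewrite mxE.
have j2 := ltn_ord j.
have -> : ((i - j <= s - 1) && (j - i <= s - 1))%N = ~~ (j < i + 1 - s)%N by lia.
by case: ifP; rewrite ?mul1r ?mul0r ?subr0 ?subrr.
Qed.

Let th : R := pi / (4 * s + 2)%:R.

Let thE : (2 * s%:R + 1) * th = pi / 2.
Proof.
rewrite /th natrD natrM; field.
by rewrite -natrM -natrD pnatr_eq0 addn_eq0 andbF.
Qed.

Let th_gt0 : 0 < th.
Proof. by rewrite divr_gt0 ?pi_gt0 // ltr0n addn_gt0 orbT. Qed.

Lemma uvec_low (i : 'I_(2 * s)) : (i < s)%N -> uvec R s i ord0 = cos ((2 * i + 1)%:R * th).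
Proof. by rewrite mxE => ->; rewrite mulrA. Qed.

(** From -cos x = cos (pi - x) and pi = (4s + 2) th. Along the indices the phases are thus
    increasing odd multiples of [th], skipping only (2s + 1) th = pi / 2, where [cos] vanishes. *)
Lemma uvec_high (i : 'I_(2 * s)) : (s <= i)%N -> uvec R s i ord0 = cos ((2 * i + 3)%:R * th).
Proof.
move=> si; rewrite mxE ltnNge si /= -mulrA -/th -[cos _ in LHS]cosN -cosDpi; congr cos.
have i2 := ltn_ord i.
have -> : (2 * (2 * s - 1 - i) + 1 = 4 * s - 1 - 2 * i)%N by lia.
have -> : pi = 2 * ((2 * s%:R + 1) * th) by rewrite thE; field.
rewrite !natrB ?natrD ?natrM; try lia.
ring.
Qed.

Let un (j : nat) : R :=
  if (j < s)%N then cos ((2 * j + 1)%:R * th) else cos ((2 * j + 3)%:R * th).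

Let uvecE (i : 'I_(2 * s)) : uvec R s i ord0 = un i.
Proof. by rewrite /un; case: ltnP => h; [exact: uvec_low|exact: uvec_high]. Qed.

Let telescope x : 2 * sin th * cos (x + th) = sin (x + 2 * th) - sin x.
Proof.
have -> : x + 2 * th = (x + th) + th by ring.
have -> : sin x = sin ((x + th) - th) by rewrite addrK.
rewrite sinD sinB; ring.
Qed.

Let prefix_low m : (m <= s)%N ->
  2 * sin th * \sum_(j < m) un j = sin (2 * m%:R * th).
Proof.
elim: m => [|m IH] ms; first by rewrite big_ord0 !mulr0 mul0r sin0.
rewrite big_ord_recr /= mulrDr IH 1?ltnW // /un ms natrD natrM.
have -> : (2 * m%:R + 1) * th = 2 * m%:R * th + th by ring.
by rewrite telescope addrC subrK -natr1; congr sin; ring.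
Qed.

(** Partial sums telescope across the skipped phase because [sin] agrees at 2s th and (2s + 2) th,
    symmetric about pi / 2. *)
Let prefix_high m : 2 * sin th * \sum_(j < s + m) un j = sin ((2 * (s + m)%:R + 2) * th).
Proof.
elim: m => [|m IH].
  rewrite addn0 prefix_low //.
  have -> : 2 * s%:R * th = pi / 2 - th by rewrite -thE; ring.
  have -> : (2 * s%:R + 2) * th = th + pi / 2 by rewrite -thE; ring.
  by rewrite sinDpihalf -[_ - th]opprB sinN sinBpihalf opprK.
rewrite addnS big_ord_recr /= mulrDr IH /un ltnNge leq_addr /= [(2 * _ + 3)%:R]natrD natrM.
have -> : (2 * (s + m)%:R + 3) * th = (2 * (s + m)%:R + 2) * th + th by ring.
by rewrite telescope addrC subrK -natr1; congr sin; ring.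
Qed.

Let total_un : 2 * sin th * \sum_(j < 2 * s) un j = 0.
Proof.
have -> : (2 * s = s + s)%N by lia.
rewrite prefix_high natrD.
have -> : (2 * (s%:R + s%:R) + 2) * th = pi / 2 + pi / 2 by rewrite -thE; ring.
by rewrite sinDpihalf cos_pihalf.
Qed.

Let th_bounds : 0 < th /\ th < pi / 2.
Proof.
split=> //; rewrite /th ltr_pM2l ?pi_gt0 // ltf_pV2 ?posrE ?ltr0n ?addn_gt0 ?orbT //.
by rewrite ltr_nat; lia.
Qed.

Let sin_th : 0 < sin th.
Proof. by apply: sin_gt0_pihalf; have [-> ->] := th_bounds. Qed.

Definition band_eigenvalue : R := (2 * sin (pi / (4 * s + 2)%:R))^-1.

Let mu := band_eigenvalue.

Let muE : mu = (2 * sin th)^-1. Proof. by []. Qed.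

Let st0 : 2 * sin th != 0. Proof. by rewrite lt0r_neq0 // mulr_gt0. Qed.

(** By [band_sum] each entry is a prefix sum or minus one, hence a sine; its phase is a quarter
    period away from that of the matching cosine. *)
Lemma band_uvec : band *m uvec R s = mu *: uvec R s.
Proof.
apply/matrixP => i j; rewrite [j]ord1 {j} [LHS]mxE [RHS]mxE uvecE.
under eq_bigr do rewrite uvecE.
rewrite (band_sum un).
apply: (mulfI st0); rewrite muE mulrA divff // mul1r.
have i2 := ltn_ord i; rewrite /un; case: ltnP => lis.
  have -> : (i + s = s + i)%N by lia.
  rewrite prefix_high -sinDpihalf -thE; congr sin.
  rewrite [(s + i)%:R]natrD [(2 * i + 1)%:R]natrD natrM; ring.
rewrite mulrBr total_un sub0r prefix_low; last by lia.
have -> : (2 * i + 3)%:R * th = 2 * (i + 1 - s)%:R * th + pi / 2.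
  by rewrite -thE natrB ?natrD ?natrM; [ring|lia].
by rewrite cosDpihalf.
Qed.

Lemma uvec_sum0 : \sum_i uvec R s i ord0 = 0.
Proof.
under eq_bigr do rewrite uvecE.
by apply: (mulfI st0); rewrite total_un mulr0.
Qed.

Lemma uvec_norm : 0 < dotv (uvec R s) (uvec R s) <= (2 * s)%:R.
Proof.
apply/andP; split; last first.
  have -> : (2 * s)%:R = \sum_(i < 2 * s) 1 :> R by rewrite sumr_const card_ord.
  rewrite dotv_sqr; apply: ler_sum => i _; rewrite uvecE.
  rewrite -(expr1n _ 2) -[leLHS]real_normK ?num_real //.
  by rewrite ler_sqr ?nnegrE // /un; case: ifP => _; exact: cos_max.
have s2 : (0 < 2 * s)%N by lia.
apply: dotv_gt0; apply/negP => /eqP/matrixP/(_ (Ordinal s2) ord0).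
rewrite uvec_low //= mxE muln0 add0n mul1r => c0.
have [t0 t1] := th_bounds.
have : 0 < cos th.
  apply: cos_gt0_pihalf; rewrite t1 andbT (lt_trans _ t0) //.
  by rewrite oppr_lt0 divr_gt0 // pi_gt0.
by rewrite c0 ltxx.
Qed.

(** From sin th <= th and (2s + 1) th = pi / 2 < 8/5. *)
Lemma band_eigenvalue_ge : 5 / 8 * s%:R <= mu.
Proof.
rewrite muE -[leRHS]mul1r ler_pdivlMr ?mulr_gt0 //.
have h1 := @sin_le_id R th (ltW th_gt0); have h2 := @pi_lt_3_2 R; have h3 := thE.
have s0 : 0 <= s%:R :> R by [].
have h4 : 5 / 8 * s%:R * (2 * sin th) <= 5 / 8 * s%:R * (2 * th).
  by rewrite ler_wpM2l ?ler_wpM2l //; apply: mulr_ge0.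
nra.
Qed.

Let rs (i : nat) : R := if (i < s)%N then i%:R + s%:R else 3 * s%:R - 1 - i%:R.

Let band_row (i : 'I_(2 * s)) : \sum_j band i j = rs i.
Proof.
have := band_sum (fun=> 1) i; under eq_bigr do rewrite mulr1.
move=> ->; rewrite !sumr_const !card_ord /rs; have i2 := ltn_ord i.
case: ltnP => lis; first by rewrite natrD.
by rewrite natrB ?natrD ?natrM; [ring|lia].
Qed.

Let sum_double (F : nat -> R) : \sum_(i < 2 * s) F i = \sum_(i < s) F i + \sum_(i < s) F (s + i)%N.
Proof.
have -> : (2 * s = s + s)%N by lia.
by rewrite big_split_ord.
Qed.

Let sum_affine N (a c : R) : \sum_(i < N) (a + c * i%:R) = N%:R * a + c * (N%:R * (N%:R - 1)) / 2.
Proof.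
elim: N => [|N IH]; first by rewrite big_ord0; field.
by rewrite big_ord_recr /= IH -natr1; field.
Qed.

Let sum_affine_sqr N (a c : R) : \sum_(i < N) (a + c * i%:R) ^+ 2 =
  N%:R * a ^+ 2 + a * c * (N%:R * (N%:R - 1)) + c ^+ 2 * (N%:R * (N%:R - 1) * (2 * N%:R - 1)) / 6.
Proof.
elim: N => [|N IH]; first by rewrite big_ord0; field.
by rewrite big_ord_recr /= IH -natr1; field.
Qed.

Let rs_low (i : 'I_s) : rs i = s%:R + 1 * i%:R.
Proof. by rewrite /rs ltn_ord; ring. Qed.

Let rs_high (i : 'I_s) : rs (s + i) = (2 * s%:R - 1) + (-1) * i%:R.
Proof. by rewrite /rs ltnNge leq_addr /= natrD; ring. Qed.

Let sum_rs : \sum_(i < 2 * s) rs i = 3 * s%:R ^+ 2 - s%:R.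
Proof.
rewrite (sum_double rs); under eq_bigr do rewrite rs_low.
under [X in _ + X]eq_bigr do rewrite rs_high.
by rewrite !sum_affine; field.
Qed.

Let sum_rs_sqr : \sum_(i < 2 * s) rs i ^+ 2 = s%:R * (14 * s%:R ^+ 2 - 9 * s%:R + 1) / 3.
Proof.
rewrite (sum_double (fun i => rs i ^+ 2)) /=; under eq_bigr do rewrite rs_low.
under [X in _ + X]eq_bigr do rewrite rs_high.
by rewrite !sum_affine_sqr; field.
Qed.

Lemma frob_band : frob band band = 3 * s%:R ^+ 2 - s%:R.
Proof.
rewrite -sum_rs; apply: eq_bigr => i _; rewrite -band_row; apply: eq_bigr => j _.
by rewrite mxE -natrM mulnb andbb.
Qed.

Definition ones_unit : 'cV[R]_(2 * s) := \col_i (Num.sqrt (2 * s)%:R)^-1.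

Definition rayleigh : R := (3 * s%:R - 1) / 2.

Definition ones_rest : 'cV[R]_(2 * s) := band *m ones_unit - rayleigh *: ones_unit.

Let c := (Num.sqrt ((2 * s)%:R : R))^-1.

Let c2 : c ^+ 2 = (2 * s%:R)^-1.
Proof. by rewrite /c exprVn sqr_sqrtr ?ler0n // natrM. Qed.

Let sR : s%:R != 0 :> R. Proof. by rewrite pnatr_eq0 -lt0n. Qed.

Let band_ones i : (band *m ones_unit) i ord0 = c * rs i.
Proof.
by rewrite mxE -band_row mulr_sumr; apply: eq_bigr => j _; rewrite [ones_unit _ _]mxE mulrC.
Qed.

Lemma ones_unit_norm : dotv ones_unit ones_unit = 1.
Proof.
rewrite dotv_sqr; under eq_bigr do rewrite mxE -/c c2.
rewrite sumr_const card_ord -[_ *+ (2 * s)]mulr_natl natrM divff //.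
by rewrite mulf_neq0.
Qed.

Lemma uvec_ones : dotv (uvec R s) ones_unit = 0.
Proof.
rewrite /dotv; under eq_bigr do rewrite [ones_unit _ _]mxE.
by rewrite -mulr_suml uvec_sum0 mul0r.
Qed.

Let ones_band_ones : dotv ones_unit (band *m ones_unit) = rayleigh.
Proof.
rewrite /dotv; under eq_bigr do rewrite band_ones [ones_unit _ _]mxE -/c mulrA -expr2.
by rewrite -mulr_sumr sum_rs c2 /rayleigh; field.
Qed.

Lemma band_ones_unit : band *m ones_unit = rayleigh *: ones_unit + ones_rest.
Proof. by rewrite addrC subrK. Qed.

Lemma ones_unit_rest : dotv ones_unit ones_rest = 0.
Proof. by rewrite dotvBr dotvZr ones_band_ones ones_unit_norm mulr1 subrr. Qed.

(** The variance of the row sums of [band], whose mean is [rayleigh]. *)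
Lemma ones_rest_norm : dotv ones_rest ones_rest = (s%:R ^+ 2 - 1) / 12.
Proof.
have h : dotv (band *m ones_unit) (band *m ones_unit) = (14 * s%:R ^+ 2 - 9 * s%:R + 1) / 6.
  rewrite dotv_sqr; under eq_bigr do rewrite band_ones exprMn.
  by rewrite -mulr_sumr sum_rs_sqr c2; field.
rewrite /ones_rest !dotv_lin h (dotvC (band *m _)) ones_band_ones ones_unit_norm.
by rewrite /rayleigh; field.
Qed.

End Band.

(** * Inversions of the eigenvector *)

Section EigenvectorClose.
Variables (R : realType) (s : nat) (p : R).
Hypotheses (p0 : 0 < p) (p1 : p < 1) (s_ge : (100 <= s)%N).

Let n := (2 * s)%N.
Let s_gt0 : (0 < s)%N. Proof. exact: leq_trans s_ge. Qed.
Let sR : 100 <= s%:R :> R. Proof. by rewrite ler_nat. Qed.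

Lemma Mhat_sym k (w : 'M[bool]_k) : (Mhat R w)^T = Mhat R w.
Proof. by apply/matrixP => i j; rewrite !mxE; case: ltngtP. Qed.

Definition uvec_unit : 'cV[R]_n := (vnorm (uvec R s))^-1 *: uvec R s.

Let u0 : 0 < vnorm (uvec R s).
Proof. by rewrite sqrtr_gt0; have /andP[] := uvec_norm R s_gt0. Qed.

Let uu : dotv uvec_unit uvec_unit = 1.
Proof.
by rewrite dotvZl dotvZr mulrA -sqr_vnorm -invfM -expr2 mulVf // expf_neq0 // lt0r_neq0.
Qed.

Let ue : dotv uvec_unit (ones_unit R s) = 0.
Proof. by rewrite dotvZl uvec_ones // mulr0. Qed.

Let Bu : band R s *m uvec_unit = band_eigenvalue R s *: uvec_unit.
Proof. by rewrite -scalemxAr band_uvec // scalerA mulrC -scalerA. Qed.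

Let defl := deflation (band R s) uvec_unit (ones_unit R s) (ones_rest R s)
              (band_eigenvalue R s) (rayleigh R s).

(** The leading coefficient is 3 - 9/4 - 2/12 = 7/12. *)
Let frob_defl : frob defl defl =
  7 / 12 * s%:R ^+ 2 + s%:R / 2 - 12^-1 - band_eigenvalue R s ^+ 2.
Proof.
rewrite /defl frob_deflation ?bandT ?ones_unit_norm ?band_ones_unit ?ones_unit_rest //.
by rewrite frob_band // ones_rest_norm // /rayleigh; field.
Qed.

Let mu_ge := @band_eigenvalue_ge R s s_gt0.

(** Nonnegativity of [frob_defl] bounds mu^2 by 7/12 s^2 plus lower order terms; no trigonometry is
    involved. *)
Let mu_le : band_eigenvalue R s <= 77 / 100 * s%:R.
Proof.
have := frob_ge0 defl; rewrite frob_defl => h.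
rewrite -ler_sqr ?nnegrE; [|by move: sR mu_ge; lra|by move: sR; lra].
by move: sR => ?; nra.
Qed.

Let defl_le : frob defl defl <= (9 / 20 * s%:R) ^+ 2.
Proof.
rewrite frob_defl.
have : (5 / 8 * s%:R) ^+ 2 <= band_eigenvalue R s ^+ 2.
  by rewrite ler_sqr ?nnegrE //; move: sR mu_ge; lra.
by move: sR => ?; nra.
Qed.

(** Replacing M by [p *: band] shifts by p times the identity, which turns 140 into 141 since p <= 1
    <= sqrt n. The factor 4 / n is n / s^2. *)
Lemma second_eigenvector_near_uvec (w : 'M[bool]_n) (lam : 'I_n -> R) (i2 : 'I_n) (y : 'cV[R]_n) :
  141 * Num.sqrt n%:R <= p * s%:R / 200 ->
  (forall x z, `|dotv x ((Mhat R w - Mmat s p) *m z)| <=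
     140 * Num.sqrt n%:R * (vnorm x * vnorm z)) ->
  eig_labelling (Mhat R w) lam -> nat_of_ord i2 = 1%N ->
  Mhat R w *m y = lam i2 *: y -> dotv y y = 1 -> 0 <= dotv y (uvec R s) ->
  dotv (y - uvec_unit) (y - uvec_unit) <= 1640 * 141 ^+ 2 * 4 / (p ^+ 2 * n%:R).
Proof.
move=> large near lab i2E yE yy yu.
have r1 : 1 <= Num.sqrt n%:R :> R.
  by rewrite -[leLHS]sqrtr1 ler_sqrt // ler1n muln_gt0.
have AB x z : `|dotv x ((Mhat R w - p *: band R s) *m z)| <=
    141 * Num.sqrt n%:R * (vnorm x * vnorm z).
  have -> : Mhat R w - p *: band R s = (Mhat R w - Mmat s p) - p%:M.
    by rewrite Mmat_band // scalerBr scalemx1 opprB addrA addrAC addrK addrC.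
  rewrite mulmxBl mul_scalar_mx dotvBr dotvZr.
  apply: le_trans (ler_normB _ _) _; have h1 := near x z.
  have h2 : `|p * dotv x z| <= Num.sqrt n%:R * (vnorm x * vnorm z).
    rewrite normrM gtr0_norm //; apply: ler_pM => //; last exact: cauchy_schwarz.
      exact: ltW.
    by apply: le_trans r1; exact: ltW.
  lra.
have ff : dotv (ones_rest R s) (ones_rest R s) <= s%:R ^+ 2 / 12.
  by rewrite ones_rest_norm //; lra.
have rho : 3 / 2 * s%:R - 2^-1 <= rayleigh R s by rewrite /rayleigh; lra.
have yu' : 0 <= dotv y uvec_unit by rewrite dotvZr mulr_ge0 // invr_ge0 ltW.
have k0 : 0 <= 141 * Num.sqrt n%:R :> R by rewrite mulr_ge0 // sqrtr_ge0.
apply: le_trans (second_eigenvector_near (bandT R s) uu (ones_unit_norm R s_gt0) ue Bu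
  (band_ones_unit R s) (ones_unit_rest R s_gt0) sR mu_ge mu_le rho ff defl_le
  (Mhat_sym w) p0 k0 large AB lab i2E yE yy yu') _.
rewrite expr_div_n [(141 * _) ^+ 2]exprMn sqr_sqrtr ?ler0n // /n natrM.
have s0 : 0 < s%:R :> R by rewrite ltr0n.
by rewrite le_eqVlt; apply/orP; left; apply/eqP; field; rewrite !lt0r_neq0.
Qed.

End EigenvectorClose.

(** * Gaps between entries of the cosine vector *)

Section UvecGap.
Variables (R : realType) (s : nat).
Hypothesis s_gt0 : (0 < s)%N.
Let n := (2 * s)%N.

Lemma cosB_prod (a b : R) : cos a - cos b = 2 * sin ((a + b) / 2) * sin ((b - a) / 2).
Proof.
have -> : cos a = cos ((a + b) / 2 - (b - a) / 2) by congr cos; field.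
have -> : cos b = cos ((a + b) / 2 + (b - a) / 2) by congr cos; field.
rewrite cosB cosD; ring.
Qed.

(** The difference of cosines is twice a product of sines: the half-difference of the phases is at
    least k th, and their half-sum stays tau th away from both 0 and pi. *)
Lemma uvec_gap (i j : 'I_n) (tau k : R) : 0 <= tau -> 0 <= k ->
  tau <= (i.+1)%:R -> tau <= n%:R - j%:R -> i%:R + k <= j%:R -> (i <= j)%N ->
  tau * k / (8 * n%:R ^+ 2) <= uvec R s i ord0 - uvec R s j ord0.
Proof.
move=> tau0 k0 ti tj kij ij.
pose th : R := pi / (4 * s + 2)%:R.
have n1 : 2 <= n%:R :> R by rewrite ler_nat /n; lia.
have thn : (2 * n%:R + 2) * th = pi.
  have -> : 2 * n%:R + 2 = (4 * s + 2)%:R :> R by rewrite /n natrD !natrM; ring.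
  by rewrite /th mulrC divfK // pnatr_eq0 addn_eq0 andbF.
have th0 : 0 < th by rewrite divr_gt0 ?pi_gt0 // ltr0n addn_gt0 orbT.
pose ph (l : 'I_n) : R := if (l < s)%N then (2 * l%:R + 1) * th else (2 * l%:R + 3) * th.
have uE l : uvec R s l ord0 = cos (ph l).
  rewrite /ph; case: ltnP => h; [rewrite uvec_low|rewrite uvec_high] => //.
    by rewrite natrD natrM.
  by rewrite natrD natrM.
have ph_ge (l : 'I_n) : (2 * l%:R + 1) * th <= ph l by rewrite /ph; case: ifP => _; nra.
have ph_le (l : 'I_n) : ph l <= (2 * l%:R + 3) * th by rewrite /ph; case: ifP => _; nra.
have ph_diff : 2 * (j%:R - i%:R) * th <= ph j - ph i.
  rewrite /ph; case: (ltnP i s) => hi; case: (ltnP j s) => hj; try nra.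
  by move: (leq_trans hi ij); rewrite leqNgt hj.
have [pi_ pj_] := (ph_ge i, ph_le j).
have i0 : 0 <= i%:R :> R by [].
have j1 : j%:R + 1 <= n%:R :> R by rewrite natr1 ler_nat.
have d0 : 0 <= j%:R - i%:R :> R by lra.
have dth : k * th <= (j%:R - i%:R) * th by rewrite ler_pM2r //; lra.
have i1 : tau * th <= (i%:R + 1) * th by rewrite ler_pM2r // natr1.
have i2 : (i%:R + 1) * th <= (2 * i%:R + 1) * th by rewrite ler_pM2r //; lra.
have j2 : tau * th <= (n%:R - j%:R) * th by rewrite ler_pM2r.
have j3 : (n%:R - j%:R) * th <= (2 * n%:R + 2) * th - (2 * j%:R + 3) * th.
  by rewrite -mulrBl ler_pM2r //; lra.
have kth : 0 <= k * th by rewrite mulr_ge0 // ltW.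
have tth : 0 <= tau * th by rewrite mulr_ge0 // ltW.
rewrite !uE cosB_prod.
have s1 : k * th / 2 <= sin ((ph j - ph i) / 2).
  apply: le_trans (sin_ge_half _); first by lra.
  by apply/andP; split; lra.
have s2 : tau * th / 2 <= sin ((ph i + ph j) / 2).
  have [h|h] := lerP ((ph i + ph j) / 2) (pi / 2).
    apply: le_trans (sin_ge_half _); first by lra.
    by apply/andP; split; lra.
  (* Past pi / 2, reflect: the distance to pi is controlled by [tj]. *)
  have -> : sin ((ph i + ph j) / 2) = sin (pi - (ph i + ph j) / 2).
    by rewrite sinB sinpi cospi mul0r sub0r mulN1r opprK.
  apply: le_trans (sin_ge_half _); first by lra.
  by apply/andP; split; lra.
have thl : (2 * n%:R)^-1 <= th.
  rewrite -[leLHS]mul1r ler_pdivrMr; last by lra.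
  by have := @pi_ge2 R; rewrite -thn; nra.
have s3 : (tau * th / 2) * (k * th / 2) <= sin ((ph i + ph j) / 2) * sin ((ph j - ph i) / 2).
  by apply: ler_pM => //; apply: divr_ge0.
have t2 : (2 * n%:R)^-1 ^+ 2 <= th ^+ 2.
  have n2 : 0 <= (2 * n%:R)^-1 :> R by rewrite invr_ge0; lra.
  by rewrite ler_sqr ?nnegrE // (ltW th0).
have tk : tau * k * (2 * n%:R)^-1 ^+ 2 <= tau * k * th ^+ 2 by rewrite ler_wpM2l // mulr_ge0.
have -> : tau * k / (8 * n%:R ^+ 2) = tau * k * (2 * n%:R)^-1 ^+ 2 / 2.
  by field; rewrite lt0r_neq0 //; lra.
lra.
Qed.

End UvecGap.

(** * Charging inversions to the ends and to the error vector *)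

Section Counting.
Variables (R : realType) (s : nat).
Hypothesis s_gt0 : (0 < s)%N.
Let n := (2 * s)%N.

Lemma count_le (N : nat) (tau : R) : 0 <= tau ->
  \sum_(i < N) ((i.+1)%:R <= tau)%R%:R <= tau.
Proof.
move=> t0; elim: N => [|N IH]; first by rewrite big_ord0.
rewrite big_ord_recr /=; case: (leP N.+1%:R tau) => h; last by rewrite addr0.
apply: le_trans h; rewrite -natr1 lerD2r.
have -> : N%:R = \sum_(i < N) 1 :> R by rewrite sumr_const card_ord.
by apply: ler_sum => i _; rewrite lern1 leq_b1.
Qed.

(** Each counted pair is charged at least 1: to an index near an end, or to the squared error at [i]
    and [j]. Summing the charges over all pairs gives the two terms. *)
Lemma Dkr_le (y : 'cV[R]_n) (tau k D : R) : 0 < tau -> 0 < k ->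
  dotv (y - uvec_unit R s) (y - uvec_unit R s) <= D ->
  (Dkr k 1 y)%:R <= 2 * tau * n%:R + 256 * n%:R ^+ 6 / (tau ^+ 2 * k ^+ 2) * D.
Proof.
move=> tau0 k0 hD.
have n1 : 0 < n%:R :> R by rewrite ltr0n muln_gt0.
pose r : R := Num.sqrt n%:R.
have r0 : 0 < r by rewrite sqrtr_gt0.
have rr : r ^+ 2 = n%:R by rewrite sqr_sqrtr ?ler0n.
pose h := (vnorm (uvec R s))^-1.
have u0 : 0 < vnorm (uvec R s) by rewrite sqrtr_gt0; have /andP[] := uvec_norm R s_gt0.
have hr : r^-1 <= h.
  rewrite lef_pV2 ?posrE // ler_sqrt ?ler0n //.
  by have /andP[] := uvec_norm R s_gt0.
(* The gap of [uvec_gap] after normalisation, the norm of [uvec] being at most sqrt n. *)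
pose g := tau * k / (8 * n%:R ^+ 2) / r.
have g0 : 0 < g by rewrite !divr_gt0 ?mulr_gt0 ?exprn_gt0.
set d := y - uvec_unit R s in hD.
pose c := 2 / g ^+ 2.
have c0 : 0 <= c by rewrite divr_ge0 ?sqr_ge0.
pose F (i j : 'I_n) : R := ((i.+1)%:R <= tau)%R%:R + (((rev_ord j).+1)%:R <= tau)%R%:R +
   c * (d i ord0 ^+ 2 + d j ord0 ^+ 2).
have key : (Dkr k 1 y)%:R <= \sum_i \sum_j F i j.
  rewrite /Dkr -sum1_card natr_sum big_mkcond /= (pair_bigA _ F) /=.
  apply: ler_sum => -[i j] _; rewrite inE /=.
  have dd : 0 <= c * (d i ord0 ^+ 2 + d j ord0 ^+ 2) by rewrite mulr_ge0 ?addr_ge0 ?sqr_ge0.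
  rewrite /F; case: ifP => [/and3P[yij kij _]|_]; last by rewrite !addr_ge0.
  case: (leP (i.+1)%:R tau) => ti; first by rewrite -addrA lerDl addr_ge0.
  case: (leP ((rev_ord j).+1)%:R tau) => tj; first by rewrite -addrA addrCA lerDl addr_ge0.
  rewrite !add0r.
  have ij : (i <= j)%N by rewrite -ltnS -(ler_nat R) (le_trans _ kij) // lerDl ltW.
  have kij' : i%:R + k <= j%:R by move: kij; rewrite -!natr1; lra.
  have nj : n%:R - j%:R = ((rev_ord j).+1)%:R :> R.
    by rewrite /= subnSK // natrB // ltnW.
  have := uvec_gap s_gt0 (ltW tau0) (ltW k0) (ltW ti) _ kij' ij.
  rewrite nj => /(_ (ltW tj)) gap.
  have g1 : g <= h * (uvec R s i ord0 - uvec R s j ord0).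
    rewrite /g mulrC; apply: ler_pM => //; first by rewrite invr_ge0 ltW.
    by rewrite divr_ge0 ?mulr_ge0 ?sqr_ge0 // ltW.
  (* At an inversion [y] increases from [i] to [j] while the normalised [uvec] drops by at least
     [g], so the error makes up the difference. *)
  have g2 : g <= d j ord0 - d i ord0.
    have dE l : d l ord0 = y l ord0 - h * uvec R s l ord0.
      by rewrite /d /uvec_unit -/h; move: (uvec R s) => v; rewrite !mxE.
    rewrite !dE; lra.
  have g3 : g ^+ 2 <= 2 * (d i ord0 ^+ 2 + d j ord0 ^+ 2).
    have : g ^+ 2 <= (d j ord0 - d i ord0) ^+ 2.
      by rewrite ler_sqr ?nnegrE ?(ltW g0) // (le_trans (ltW g0)).
    move: (sqr_ge0 (d i ord0 + d j ord0)) (g ^+ 2) => + q.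
    move: (d i ord0) (d j ord0) => a b.
    by lra.
  by rewrite /c mulrAC ler_pdivlMr ?exprn_gt0 // mul1r.
apply: le_trans key _.
have -> : \sum_i \sum_j F i j =
   n%:R * \sum_(i < n) ((i.+1)%:R <= tau)%R%:R + n%:R * \sum_(i < n) ((i.+1)%:R <= tau)%R%:R +
   2 * n%:R * c * dotv d d.
  rewrite /F; under eq_bigr do rewrite !big_split /= -mulr_sumr big_split /= !sumr_const card_ord.
  rewrite !big_split /= -mulr_sumr big_split /= !sumr_const card_ord -dotv_sqr.
  have -> : \sum_(j < n) ((n - j.+1).+1%:R <= tau)%R%:R = \sum_(i < n) (i.+1%:R <= tau)%R%:R :> R.
    by rewrite [RHS](reindex_inj rev_ord_inj).
  rewrite !sumrMnl -dotv_sqr; move: (dotv d d) (\sum_(i < n) _) => ? ?; ring.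
have cl := count_le n (ltW tau0).
have -> : 256 * n%:R ^+ 6 / (tau ^+ 2 * k ^+ 2) * D = 2 * n%:R * c * D.
  rewrite /c /g !expr_div_n rr; field. by rewrite !lt0r_neq0.
have cl2 : n%:R * \sum_(i < n) ((i.+1)%:R <= tau)%R%:R <= n%:R * tau by rewrite ler_pM2l.
have hc : 0 <= 2 * n%:R * c by apply: mulr_ge0 => //; rewrite mulr_ge0.
have : 2 * n%:R * c * dotv d d <= 2 * n%:R * c * D by rewrite ler_wpM2l.
lra.
Qed.

End Counting.

(** * Choice of the constants *)

Lemma Dkr_le_sqr (R : realType) (n : nat) (k r : R) (y : 'cV[R]_n) :
  (Dkr k r y <= n ^ 2)%N.
Proof. by apply: leq_trans (max_card _) _; rewrite card_prod !card_ord. Qed.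

(** The choice of [tau] is the balance tau^3 k^2 = x^4. The extra factor [x] in the second identity
    is cancelled by the squared error, of order 1 / x. *)
Lemma powR_exponents (R : realType) (x beta : R) : 0 < x ->
  let tau := x `^ ((4 - 2 * beta) / 3) in let k := x `^ beta in
  tau * x = x `^ ((7 - 2 * beta) / 3) /\
  x ^+ 6 / (tau ^+ 2 * k ^+ 2) = x * x `^ ((7 - 2 * beta) / 3).
Proof.
move=> x0 tau k.
have xn : x != 0 by rewrite lt0r_neq0.
have pD a b : x `^ (a + b) = x `^ a * x `^ b by rewrite powRD // xn implybT.
have x1 : x = x `^ 1 by rewrite powRr1 // ltW.
have tx : tau * x = x `^ ((7 - 2 * beta) / 3).
  by rewrite [X in _ * X]x1 -pD; congr powR; field.
have t0 : tau != 0 by rewrite lt0r_neq0 // powR_gt0.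
have k0 : k != 0 by rewrite lt0r_neq0 // powR_gt0.
split=> //; rewrite -tx.
have t3k : tau ^+ 3 * k ^+ 2 = x ^+ 4.
  rewrite -!powR_mulrn ?powR_ge0 // -?powRrM -?pD; last exact: ltW.
  by congr powR; field.
apply: (mulIf (_ : tau ^+ 2 * k ^+ 2 != 0)); first by rewrite mulf_neq0 ?expf_neq0.
rewrite divfK ?mulf_neq0 ?expf_neq0 //.
have -> : x ^+ 6 = x ^+ 2 * (tau ^+ 3 * k ^+ 2) by rewrite t3k; ring.
ring.
Qed.

(** The exponent may have either sign, depending on [beta]; this lets one constant cover all sizes
    up to [N]. *)
Lemma powR_ge_inv (R : realType) (x N a : R) : 1 <= x -> x <= N ->
  (N `^ `|a|)^-1 <= x `^ a.
Proof.
move=> x1 xN.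
have x0 : 0 < x by exact: lt_le_trans x1.
have N0 : 0 < N by exact: lt_le_trans xN.
apply: (@le_trans _ _ (x `^ (- `|a|))).
  rewrite powRN lef_pV2 ?posrE ?powR_gt0 //.
  by apply: ge0_ler_powR; rewrite ?nnegrE // ltW.
by apply: ler_powR => //; rewrite lerNl -normrN ler_norm.
Qed.

Unset Implicit Arguments.
Set Strict Implicit.
Set Printing Implicit Defensive.

(** The probability is carried by a set of outcomes, on which the bound holds for all labellings and
    all admissible [y]; ties in absolute value need no convention. *)
Theorem theorem3 (R : realType) (p beta : R) (hp0 : 0 < p) (hp1 : p < 1)
    (hbeta : 0 <= beta) :
  exists C : R, 0 < C /\
  forall s : nat, (0 < s)%N ->
  exists G : {set 'M[bool]_(2 * s)},
    1 - (((2 * s)%:R : R) ^+ 3)^-1 <= \sum_(w in G) weight (Mmat s p) w /\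
    forall w, w \in G ->
    forall lam : 'I_(2 * s) -> R, eig_labelling (Mhat R w) lam ->
    forall (i2 : 'I_(2 * s)), nat_of_ord i2 = 1%N ->
    forall y : 'cV[R]_(2 * s),
      Mhat R w *m y = lam i2 *: y ->
      dotv y y = 1 ->
      0 <= dotv y (uvec R s) ->
      ((Dkr (((2 * s)%:R : R) `^ beta) 1 y)%:R : R)
        < C * ((2 * s)%:R `^ ((7 - 2 * beta) / 3)).
Proof.
pose a : R := (7 - 2 * beta) / 3.
pose K1 : R := 1640 * 141 ^+ 2 * 4 / p ^+ 2.
have c0 : 0 <= 1640 * 141 ^+ 2 * 4 :> R by lra.
have K10 : 0 <= 256 * K1 := mulr_ge0 (ler0n R 256) (divr_ge0 c0 (sqr_ge0 p)).
(* As s = n / 2, the condition 141 sqrt n <= p s / 200 means sqrt n >= 141 * 400 / p = [b]. *)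
pose b : R := 564 * 100 / p.
have c1 : 0 < 564 * 100 :> R by lra.
have b0 : 0 < b := divr_gt0 c1 hp0.
pose s0 := (100 + Num.truncn (b ^+ 2))%N.
pose N : R := (2 * s0)%:R.
have X0 : 0 < N `^ `|a| by rewrite powR_gt0 // ltr0n.
have C2 : 0 <= N ^+ 2 * N `^ `|a| by rewrite mulr_ge0 ?sqr_ge0 // ltW.
(* 2 for the pairs near the ends, 1 for strictness, [256 * K1] for the error term, and the last
   summand for [s <= s0]. *)
exists (3 + 256 * K1 + N ^+ 2 * N `^ `|a|); split.
  by rewrite ltr_wpDr // ltr_wpDr.
move=> s s_gt0.
have n_gt0 : (0 < 2 * s)%N by rewrite muln_gt0.
have m01 (i j : 'I_(2 * s)) : 0 <= Mmat s p i j <= 1.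
  by rewrite mxE; case: ifP => _; rewrite ?lexx ?ler01 // !ltW.
have mT : (Mmat s p)^T = Mmat s p.
  by apply/matrixP => i j; rewrite !mxE eq_sym; congr (if _ && _ then _ else _); rewrite andbC.
have mdiag (i : 'I_(2 * s)) : Mmat s p i i = 0 by rewrite mxE eqxx.
have [G [GP Gnorm]] := operator_norm_event n_gt0 m01 mT mdiag.
exists G; split=> // w wG lam lab i2 i2E y yE yy yu; rewrite -/a.
set x : R := (2 * s)%:R.
have x1 : 1 <= x by rewrite ler1n.
have x0 : 0 < x by exact: lt_le_trans x1.
have xa : 0 < x `^ a by rewrite powR_gt0.
(* Small sizes use only the trivial count n^2. *)
case: (leqP s s0) => ss.
  have Nx : x <= N by rewrite ler_nat leq_mul2l ss orbT.
  have h1 : (Dkr (x `^ beta) 1 y)%:R <= N ^+ 2.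
    apply: (@le_trans _ _ (x ^+ 2)); first by rewrite -natrX ler_nat Dkr_le_sqr.
    by rewrite lerXn2r ?nnegrE ?(ltW x0) ?ler0n.
  have h2 := powR_ge_inv a x1 Nx.
  have h3 : N ^+ 2 <= N ^+ 2 * N `^ `|a| * x `^ a.
    by rewrite -mulrA ler_peMr ?sqr_ge0 // -ler_pdivrMl // mulr1.
  have h4 := mulr_ge0 K10 (ltW xa).
  lra.
have large : 141 * Num.sqrt x <= p * s%:R / 200.
  have r0 : 0 < Num.sqrt x by rewrite sqrtr_gt0.
  have br : b <= Num.sqrt x.
    rewrite -ler_sqr ?nnegrE ?(ltW b0) ?(ltW r0) // sqr_sqrtr ?(ltW x0) //.
    apply: (@le_trans _ _ ((Num.truncn (b ^+ 2)).+1%:R)); first by rewrite ltW // truncnS_gt.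
    rewrite /x ler_nat; apply: leq_trans (leq_pmull s (isT : 0 < 2)%N).
    by apply: leq_trans ss; rewrite ltnS leq_addl.
  have sr : Num.sqrt x ^+ 2 = 2 * s%:R by rewrite sqr_sqrtr ?(ltW x0) // /x natrM.
  have h : p * b * Num.sqrt x <= p * Num.sqrt x ^+ 2.
    by rewrite -mulrA expr2 ler_pM2l // ler_pM2r.
  have pb : p * b = 564 * 100 by rewrite /b mulrC divfK // lt0r_neq0.
  rewrite pb sr in h; lra.
have s100 : (100 <= s)%N by apply: leq_trans (ltnW ss); rewrite leq_addr.
have near := second_eigenvector_near_uvec hp0 hp1 s100 large (Gnorm w wG) lab i2E yE yy yu.
pose tau := x `^ ((4 - 2 * beta) / 3).
have := Dkr_le s_gt0 (_ : 0 < tau) (_ : 0 < x `^ beta) near; rewrite !powR_gt0 // => /(_ isT isT).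
have [e1 e2] := powR_exponents beta x0.
rewrite -/x -/tau in e1 e2 *.
rewrite -(mulrA 2) e1 -(mulrA 256 _ _^-1) e2 -/a => h.
have E : 256 * (x * x `^ a) * (1640 * 141 ^+ 2 * 4 / (p ^+ 2 * x)) = 256 * K1 * x `^ a.
  by rewrite /K1; field; rewrite (lt0r_neq0 hp0) pnatr_eq0 -lt0n.
rewrite E in h.
have := mulr_ge0 C2 (ltW xa).
lra.
Qed.
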